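(* Let $r\geq 1$, let $n\geq 2$ be even, and let $\iota:K_2\to C_{2r+1}$ be one of the two graph homomorphisms mapping the edge of $K_2$ to the $\mathbb{Z}_2$-invariant edge $\{r,r+1\}$ of $C_{2r+1}$. Let $$\iota_{K_n}^*:\widetilde H^*(\mathrm{Hom}(K_2,K_n);\mathbb{Z})\to \widetilde H^*(\mathrm{Hom}(C_{2r+1},K_n);\mathbb{Z})$$ be the map induced by $\iota_{K_n}:\mathrm{Hom}(C_{2r+1},K_n)\to\mathrm{Hom}(K_2,K_n)$. Then $2\cdot\iota_{K_n}^*$ is the zero map (in every degree $\geq 0$).
   Context: Graphs are undirected. $C_{2r+1}$ is the cycle with $V(C_{2r+1})=\mathbb{Z}_{2r+1}$ (identified with $\{1,\dots,2r+1\}$) and $E(C_{2r+1})=\{(x,x+1),(x+1,x)\mid x\in\mathbb{Z}_{2r+1}\}$. $\mathbb{Z}_2$ acts on $C_{2r+1}$ by $[x]_{2r+1}\mapsto[-x]_{2r+1}$; this fixes the vertex $2r+1$ and flips the edge $(r,r+1)$. $K_n$ is the complete graph with $V(K_n)=\{1,\dots,n\}$, $E(K_n)=\{(x,y)\mid x\neq y\}$. For graphs $G$ and $H$, $\mathrm{Hom}(G,H)$ is the polyhedral complex whose cells are indexed by all functions $\eta:V(G)\to 2^{V(H)}\setminus\{\emptyset\}$ such that whenever $(x,y)\in E(G)$, $\tilde x\in\eta(x)$ and $\tilde y\in\eta(y)$, we have $(\tilde x,\tilde y)\in E(H)$. The cell $\eta$ is the direct product over $v\in V(G)$ of the simplices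 with vertex sets $\eta(v)$, and its closure consists of all cells $\tilde\eta$ with $\tilde\eta(v)\subseteq\eta(v)$ for all $v$. A graph homomorphism $\phi:G\to G'$ induces the cellular map $\phi_H:\mathrm{Hom}(G',H)\to\mathrm{Hom}(G,H)$, $\eta\mapsto\eta\circ\phi$. $\widetilde H^*$ denotes reduced cohomology (in degrees $\ge 0$, it is $0$ for the empty space). *)

(* Defs.v *)
From HB Require Import structures.
From mathcomp Require Import all_boot all_order all_algebra.
From mathcomp Require Import ring_quotient.
From mathcomp Require Import boolp.

Set Implicit Arguments.
Unset Strict Implicit.
Unset Printing Implicit Defensive.

Import Order.TTheory GRing.Theory Num.Theory.
Local Open Scope ring_scope.
Local Open Scope quotient_scope.

(** Finite undirected graphs (loops allowed). *)

Record graph := Graph {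
  nvertices : nat;
  edge : rel 'I_nvertices;
  edge_sym : symmetric edge
}.

Notation vertex G := 'I_(nvertices G).

Definition graph_hom (G G' : graph) (phi : vertex G -> vertex G') :=
  forall x y, edge x y -> edge (phi x) (phi y).

Lemma complete_sym n : symmetric (fun x y : 'I_n => x != y).
Proof. by move=> x y; rewrite eq_sym. Qed.

(* The label i of 'I_n stands for the vertex i + 1. *)
Definition complete_graph n := Graph (@complete_sym n).

Definition cycle_edge r (x y : 'I_(r.*2.+1)) : bool :=
  (y == x.+1 %% r.*2.+1 :> nat)%N || (x == y.+1 %% r.*2.+1 :> nat)%N.

Lemma cycle_sym r : symmetric (@cycle_edge r).
Proof. by move=> x y; rewrite /cycle_edge orbC. Qed.

(* Vertices are residues modulo 2r+1; the vertex called 2r+1 is the residue 0. *)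
Definition cycle_graph r := Graph (@cycle_sym r).

(** The polyhedral complex Hom(G, H). *)

Section HomComplex.
Variables G H : graph.

Definition setfun := {ffun vertex G -> {set vertex H}}.

Definition is_cell (eta : setfun) : bool :=
  [forall v, eta v != set0] &&
  [forall x, forall y, edge x y ==>
     [forall a in eta x, forall b in eta y, edge a b]].

(* dimension of the product of the simplices spanned by the eta v *)
Definition celldim (eta : setfun) : nat := (\sum_v #|eta v|.-1)%N.

(* For w in eta v and 1 < #|eta v|, this is a facet of eta, and all facets of
   eta are of this form. *)
Definition facet (eta : setfun) (v : vertex G) (w : vertex H) : setfun :=
  [ffun u => if u == v then eta u :\ w else eta u].

(* Each simplex is oriented by the order of 'I_(nvertices H), and a product of
   simplices by the order of its factors in 'I_(nvertices G); the incidence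
   number of the facet in the product is (-1) ^+ facet_sign, by the boundary
   formula of a tensor product of simplicial chain complexes. *)
Definition facet_sign (eta : setfun) (v : vertex G) (w : vertex H) : nat :=
  (\sum_(u : vertex G | (u < v)%N) #|eta u|.-1 +
   #|[set a in eta v | (a < w)%N]|)%N.

(** Cellular cochains with integer coefficients. A cochain of degree k is
    encoded as a function on all setfuns that vanishes away from the cells of
    dimension k. *)

Definition cochains := {ffun setfun -> int}.

Definition cochain (k : nat) (c : cochains) : bool :=
  [forall eta, (c eta != 0) ==> is_cell eta && (celldim eta == k)].

Definition coboundary (c : cochains) : cochains :=
  [ffun eta => if is_cell eta then
     \sum_v \sum_(w in eta v | (1 < #|eta v|)%N)
        (-1) ^+ facet_sign eta v w * c (facet eta v w)
   else 0].

(* the coboundary from degree -1, where the reduced complex is the integers *)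
Definition augmentation (a : int) : cochains :=
  [ffun eta => if is_cell eta && (celldim eta == 0%N) then a else 0].

Definition cocycle (k : nat) : {pred cochains} :=
  fun c : cochains => cochain k c && (coboundary c == 0).

Definition is_reduced_coboundary (k : nat) (c : cochains) : Prop :=
  if k is j.+1 then exists2 b, cochain j b & c = coboundary b
  else exists a, c = augmentation a.

Lemma cochainP k (c : cochains) :
  reflect (forall eta, ~~ (is_cell eta && (celldim eta == k)) -> c eta = 0)
          (cochain k c).
Proof.
apply: (iffP forallP) => h eta.
  by move=> /negPf he; move: (h eta); rewrite he implybF negbK => /eqP.
by apply/implyP; apply: contraR => /h ->.
Qed.

Lemma cochain_zmod_closed k : zmod_closed (cochain k).
Proof.
split; first by apply/cochainP => eta _; rewrite ffunE.
move=> b c /cochainP hb /cochainP hc; apply/cochainP => eta he.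
by rewrite !ffunE hb // hc // subrr.
Qed.

Lemma coboundary_is_zmod_morphism : zmod_morphism coboundary.
Proof.
move=> b c; apply/ffunP => eta; rewrite !ffunE; case: ifP => _; last first.
  by rewrite subrr.
rewrite -sumrB; apply: eq_bigr => v _; rewrite -sumrB; apply: eq_bigr => w _.
by rewrite !ffunE mulrBr.
Qed.
HB.instance Definition _ :=
  GRing.isZmodMorphism.Build cochains cochains coboundary
    coboundary_is_zmod_morphism.

Lemma augmentation_is_zmod_morphism : zmod_morphism augmentation.
Proof.
by move=> a b; apply/ffunP => eta; rewrite !ffunE; case: ifP; rewrite ?subrr.
Qed.
HB.instance Definition _ :=
  GRing.isZmodMorphism.Build int cochains augmentation
    augmentation_is_zmod_morphism.

Lemma cocycle_zmod_closed k : zmod_closed (cocycle k).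
Proof.
have [h0 hB] := cochain_zmod_closed k.
split; first by rewrite unfold_in raddf0 eqxx andbT; exact: h0.
move=> b c /andP[hb /eqP eb] /andP[hc /eqP ec].
by rewrite unfold_in raddfB /= eb ec subrr eqxx andbT; exact: hB.
Qed.
HB.instance Definition _ k :=
  GRing.isZmodClosed.Build cochains (cocycle k) (cocycle_zmod_closed k).

Record cocycles (k : nat) :=
  Cocycle { cochain_of :> cochains; cocycleP : cochain_of \in cocycle k }.
HB.instance Definition _ k := [isSub for @cochain_of k].
HB.instance Definition _ k := [Choice of cocycles k by <:].
HB.instance Definition _ k := [SubChoice_isSubZmodule of cocycles k by <:].

Definition coboundaries (k : nat) : {pred cocycles k} :=
  fun z : cocycles k => `[< is_reduced_coboundary k z >].

Lemma coboundaries_zmod_closed k : zmod_closed (@coboundaries k).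
Proof.
split; first apply/asboolP.
  case: k => [|j] /=; first by exists 0; rewrite raddf0.
  by exists 0; [exact: (cochain_zmod_closed j).1 | rewrite raddf0].
move=> x y /asboolP hx /asboolP hy; apply/asboolP.
case: k x y hx hy => [|j] x y /=.
  by move=> [a ea] [b eb]; exists (a - b); rewrite ea eb raddfB.
move=> [a ha ea] [b hb eb]; exists (a - b); last by rewrite ea eb raddfB.
exact: (cochain_zmod_closed j).2.
Qed.
HB.instance Definition _ k :=
  GRing.isZmodClosed.Build (cocycles k) (@coboundaries k)
    (coboundaries_zmod_closed k).

(** The k-th reduced cohomology group of Hom(G, H), for k >= 0. *)
Definition red_cohomology (k : nat) : zmodType :=
  Quotient.quot (@coboundaries k).

End HomComplex.

(** The map induced by an injective graph homomorphism phi : G -> G'.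
    On the cell eta of Hom(G', H), the map Hom(G', H) -> Hom(G, H) is the
    projection of the product of the eta v', v' in G', onto the factors
    v' = phi v, listed in the order of G. On cellular chains, it kills eta if
    the dimension drops, and otherwise (the discarded factors are points) it
    sends eta to eta \o phi with the sign of the reordering of the remaining
    factors, a factor of dimension p moved past one of dimension q giving
    (-1)^(p q). *)

Section InducedMap.
Variables (G G' H : graph) (phi : vertex G -> vertex G').

Definition pull_cell (eta : setfun G' H) : setfun G H :=
  [ffun v => eta (phi v)].

Definition reorder_sign (eta : setfun G' H) : nat :=
  (\sum_(u : vertex G) \sum_(v : vertex G | (u < v)%N && (phi v < phi u)%N)
     #|eta (phi u)|.-1 * #|eta (phi v)|.-1)%N.

Definition pullback (c : cochains G H) : cochains G' H :=
  [ffun eta =>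
     if is_cell eta && (celldim (pull_cell eta) == celldim eta)
     then (-1) ^+ reorder_sign eta * c (pull_cell eta) else 0].

Lemma pullback_is_zmod_morphism : zmod_morphism pullback.
Proof.
move=> b c; apply/ffunP => eta; rewrite !ffunE; case: ifP => _; last first.
  by rewrite subrr.
by rewrite mulrBr.
Qed.
HB.instance Definition _ :=
  GRing.isZmodMorphism.Build (cochains G H) (cochains G' H) pullback
    pullback_is_zmod_morphism.

Lemma pullback_cochain k (c : cochains G H) :
  cochain k c -> cochain k (pullback c).
Proof.
move=> /cochainP hc; apply/cochainP => eta he; rewrite ffunE.
case: ifP => // /andP[ce /eqP de]; rewrite hc ?mulr0 // de.
by apply: contra he => /andP[_ ->]; rewrite ce.
Qed.

Hypothesis phi_hom : graph_hom phi.
Hypothesis phi_inj : injective phi.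

Lemma pull_is_cell eta : is_cell eta -> is_cell (pull_cell eta).
Proof.
move=> /andP[/forallP ne /forallP he]; apply/andP; split.
  by apply/forallP => v; rewrite ffunE.
apply/forallP => x; apply/forallP => y; apply/implyP => /phi_hom hxy.
by rewrite !ffunE; move: (he (phi x)) => /forallP/(_ (phi y))/implyP; apply.
Qed.

Let off (eta : setfun G' H) : nat :=
  (\sum_(v | v \notin phi @: [set: vertex G]) #|eta v|.-1)%N.

Lemma celldim_pull eta :
  celldim eta = (celldim (pull_cell eta) + off eta)%N.
Proof.
rewrite /celldim (bigID (fun v => v \in phi @: [set: vertex G])) /=.
congr (_ + _)%N; rewrite big_imset /=; last by move=> x y _ _; exact: phi_inj.
by apply: eq_big => [v|v _]; rewrite ?inE ?ffunE.
Qed.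

Lemma celldim_pull_eq eta :
  (celldim (pull_cell eta) == celldim eta) = (off eta == 0)%N.
Proof. by rewrite celldim_pull -{1}[celldim _]addn0 eqn_add2l eq_sym. Qed.

Lemma facet_cell (eta : setfun G' H) v w :
  is_cell eta -> (1 < #|eta v|)%N -> is_cell (facet eta v w).
Proof.
move=> /andP[/forallP ne /forallP he] h1.
have sub u : facet eta v w u \subset eta u.
  by rewrite ffunE; case: ifP => // _; exact: subD1set.
apply/andP; split.
  apply/forallP => u; rewrite ffunE; case: (eqVneq u v) => [->|_]; last exact: ne.
  rewrite -card_gt0; move: h1; rewrite (cardsD1 w (eta v)).
  by case: (w \in _); rewrite ?add0n ?add1n // => /ltnW.
apply/forallP => x; apply/forallP => y; apply/implyP => exy.
move: (he x) => /forallP/(_ y)/implyP/(_ exy)/forallP hxy.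
apply/forallP => a; apply/implyP => /(subsetP (sub x)) ha.
move: (hxy a) => /implyP/(_ ha)/forallP hb.
apply/forallP => b; apply/implyP => /(subsetP (sub y)) hb'.
by move: (hb b) => /implyP; apply.
Qed.

Lemma pull_facet_on eta v w :
  pull_cell (facet eta (phi v) w) = facet (pull_cell eta) v w.
Proof. by apply/ffunP => u; rewrite !ffunE (inj_eq phi_inj). Qed.

Lemma pull_facet_off eta v w : v \notin phi @: [set: vertex G] ->
  pull_cell (facet eta v w) = pull_cell eta.
Proof.
move=> hv; apply/ffunP => u; rewrite !ffunE; case: eqP => // e.
by case/negP: hv; rewrite -e imset_f.
Qed.

Lemma off_facet_on eta v w : off (facet eta (phi v) w) = off eta.
Proof.
apply: eq_bigr => u hu; rewrite ffunE; case: eqP => // e.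
by case/negP: hu; rewrite e imset_f.
Qed.

Lemma card_facet (eta : setfun G' H) v w u : w \in eta v ->
  #|eta u|.-1 = (#|facet eta v w u|.-1 + ((u == v) && (1 < #|eta v|)%N))%N.
Proof.
move=> hw; rewrite ffunE; case: eqP => [->|_]; last by rewrite addn0.
by rewrite (cardsD1 w (eta v)) hw add1n /=; case: #|_| => [|m] //=; rewrite addn1.
Qed.

Lemma off_facet_off (eta : setfun G' H) v w : v \notin phi @: [set: vertex G] ->
  w \in eta v -> (1 < #|eta v|)%N -> off eta = (off (facet eta v w)).+1.
Proof.
move=> hv hw h1; rewrite /off.
under eq_bigr => u _ do rewrite (card_facet u hw) h1 andbT.
rewrite big_split /= -addn1; congr (_ + _)%N.
by rewrite (bigD1 v) //= eqxx big1 // => u /andP[_ /negPf ->].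
Qed.

Lemma pair_sum (A : {set vertex H}) : #|A| = 2 ->
  \sum_(w in A) (-1) ^+ #|[set a in A | (a < w)%N]| = 0 :> int.
Proof.
move=> /eqP/cards2P[x [y [nxy ->]]].
wlog lxy : x y nxy / (x < y)%N => [hw|].
  case: (ltngtP x y) => [h|h|/val_inj e]; first exact: hw.
    by rewrite setUC; apply: hw; rewrite // eq_sym.
  by rewrite e eqxx in nxy.
rewrite big_setU1 ?inE //= big_set1.
have -> : [set a in [set x; y] | (a < x)%N] = set0.
  apply/setP => a; rewrite !inE; case: eqP => [->|_] /=; first by rewrite ltnn.
  by case: eqP => //= ->; rewrite ltnNge ltnW.
have -> : [set a in [set x; y] | (a < y)%N] = [set x].
  apply/setP => a; rewrite !inE; case: eqP => [->|_] //=.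
  by case: eqP => //= ->; rewrite ltnn.
by rewrite cards0 cards1.
Qed.

Lemma pull_sign (eta : setfun G' H) v w : w \in eta (phi v) -> (1 < #|eta (phi v)|)%N ->
  off eta = 0%N ->
  (-1) ^+ (facet_sign eta (phi v) w + reorder_sign (facet eta (phi v) w)) =
  (-1) ^+ (reorder_sign eta + facet_sign (pull_cell eta) v w) :> int.
Proof.
move=> hw h1 h0.
pose d u := #|eta (phi u)|.-1.
pose d' u := #|facet eta (phi v) w (phi u)|.-1.
have dd' u : d u = (d' u + (u == v))%N.
  by rewrite /d (card_facet (phi u) hw) h1 andbT (inj_eq phi_inj).
pose inv (u x : vertex G) : bool := ((u < x) && (phi x < phi u))%N.
have -> : reorder_sign eta = (reorder_sign (facet eta (phi v) w) +
    (\sum_(u | inv u v) d u + \sum_(u | inv v u) d u))%N.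
  rewrite /reorder_sign.
  transitivity (\sum_u (\sum_(x | inv u x) d' u * d' x +
     (\sum_(x | inv u x) d' u * (x == v) +
      \sum_(x | inv u x) (u == v) * d x)))%N.
    apply: eq_bigr => u _; rewrite -!big_split; apply: eq_bigr => x _ /=.
    by rewrite -/(d u) -/(d x) (dd' u) mulnDl {1}(dd' x) mulnDr addnA.
  rewrite big_split /=; congr (_ + _)%N; rewrite big_split /=; congr (_ + _)%N.
    rewrite [RHS]big_mkcond; apply: eq_bigr => u _.
    rewrite big_mkcond (bigD1 v) //= big1 ?addn0; last first.
      by move=> x /negPf ->; rewrite muln0 if_same.
    rewrite eqxx muln1 (dd' u); case: ifP => //.
    by case: eqP => [->|_]; rewrite ?addn0 // /inv ltnn.
  rewrite (bigD1 v) //= [X in (_ + X)%N]big1 ?addn0; last first.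
    by move=> u /negPf ->; rewrite big1.
  by apply: eq_bigr => x _; rewrite eqxx mul1n.
have -> : facet_sign eta (phi v) w =
    (\sum_(u | (phi u < phi v)%N) d u + #|[set a in eta (phi v) | (a < w)%N]|)%N.
  congr (_ + _)%N.
  rewrite (bigID (fun u => u \in phi @: [set: vertex G])) /=.
  rewrite [X in (_ + X)%N]big1 ?addn0; last first.
    move=> u /andP[_ hu]; move/eqP: h0; rewrite sum_nat_eq0.
    by move=> /forallP/(_ u)/implyP/(_ hu)/eqP.
  rewrite big_mkcondl /= big_imset /=; last first.
    by move=> x y _ _; exact: phi_inj.
  by rewrite [RHS]big_mkcond; apply: eq_big => [u|u _]; rewrite ?inE.
have -> : facet_sign (pull_cell eta) v w =
    (\sum_(u : vertex G | (u < v)%N) d u +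
     #|[set a in eta (phi v) | (a < w)%N]|)%N.
  by rewrite /facet_sign ffunE; congr (_ + _)%N; apply: eq_bigr => u _;
     rewrite ffunE.
have key : (\sum_(u | (phi u < phi v)%N) d u + \sum_(u | inv u v) d u =
            \sum_(u : vertex G | (u < v)%N) d u + \sum_(u | inv v u) d u)%N.
  rewrite ![(\sum_(u | _) d u)%N]big_mkcond -!big_split /=.
  apply: eq_bigr => u _; rewrite /inv.
  have : (phi u == phi v :> nat) = (u == v :> nat).
    exact: (inj_eq phi_inj).
  by case: (ltngtP u v); case: (ltngtP (phi u) (phi v)); rewrite //= ?addn0.
rewrite -signr_odd -[RHS]signr_odd; congr (_ ^+ nat_of_bool _).
by move: key => /(congr1 odd); rewrite !oddD; do 6!case: (odd _).
Qed.

Lemma coboundary_pullback (c : cochains G H) :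
  coboundary (pullback c) = pullback (coboundary c).
Proof.
apply/ffunP => eta; rewrite !ffunE.
case: ifPn => //= ce; rewrite celldim_pull_eq pull_is_cell //.
rewrite (bigID (fun v => v \in phi @: [set: vertex G])) /=.
rewrite big_imset /=; last by move=> x y _ _; exact: phi_inj.
case: eqP => h0.
  rewrite [X in _ + X]big1 ?addr0; last first.
    move=> v hv; rewrite big1 // => w /andP[_ h1].
    move/eqP: h0; rewrite sum_nat_eq0 => /forallP/(_ v)/implyP/(_ hv).
    by case: #|_| h1 => [|[]].
  rewrite mulr_sumr; apply: eq_big => [v|v _]; first by rewrite inE.
  rewrite mulr_sumr; apply: eq_big => [w|w /andP[hw h1]]; first by rewrite ffunE.
  rewrite ffunE facet_cell // celldim_pull_eq off_facet_on h0 eqxx /=.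
  by rewrite !mulrA -!exprD pull_sign // pull_facet_on.
rewrite big1 ?add0r; last first.
  move=> v _; rewrite big1 // => w /andP[hw h1].
  by rewrite ffunE celldim_pull_eq off_facet_on (introF eqP h0) andbF mulr0.
rewrite big1 // => v hv.
case: (ltnP 1 #|eta v|) => [h1|_]; last by rewrite big1 // => w; rewrite andbF.
case: (eqVneq (off eta) 1%N) => [e1|n1]; last first.
  rewrite big1 // => w; rewrite andbT => hw.
  rewrite ffunE celldim_pull_eq; move: n1; rewrite (off_facet_off hv hw h1).
  by rewrite eqSS => /negPf ->; rewrite andbF mulr0.
have e2 : #|eta v| = 2.
  move: e1; rewrite /off (bigD1 v) //=; case: #|_| h1 => [|[|[|m]]] //=.
have := pair_sum e2.
pose K := (-1) ^+ (\sum_(u : vertex G' | (u < v)%N) #|eta u|.-1) *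
  ((-1) ^+ reorder_sign eta * c (pull_cell eta)).
move=> /(congr1 (fun x => x * K)); rewrite mul0r mulr_suml => e0.
rewrite -[RHS]e0.
apply: eq_big => [w|w]; rewrite andbT // => hw.
rewrite ffunE facet_cell // celldim_pull_eq.
move: e1; rewrite (off_facet_off hv hw h1) => -[->] /=.
rewrite pull_facet_off // /facet_sign exprD /K.
have -> : reorder_sign (facet eta v w) = reorder_sign eta.
  have hx x : facet eta v w (phi x) = eta (phi x).
    by move/ffunP: (pull_facet_off eta w hv) => /(_ x); rewrite !ffunE.
  by apply: eq_bigr => x _; apply: eq_bigr => y _; rewrite !hx.
by rewrite -mulrA [RHS]mulrCA.
Qed.

Lemma pullback_augmentation (a : int) :
  pullback (augmentation G H a) = augmentation G' H a.
Proof.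
apply/ffunP => eta; rewrite !ffunE celldim_pull_eq.
case: ifPn => [/andP[ce /eqP h0]|].
  rewrite pull_is_cell // ce /= [celldim eta]celldim_pull h0 addn0.
  case: eqP => [d0|_]; last by rewrite mulr0.
  rewrite /reorder_sign big1 ?expr0 ?mul1r // => u _.
  rewrite big1 // => v _; move/eqP: d0.
  rewrite sum_nat_eq0 => /forallP/(_ u); rewrite ffunE => /eqP ->.
  by rewrite mul0n.
rewrite negb_and; case: (is_cell eta) => //=.
by rewrite celldim_pull addn_eq0 => /negPf ->; rewrite andbF.
Qed.

Lemma pullback_cocycleP k (z : cocycles G H k) : pullback z \in cocycle k.
Proof.
have /andP[hz /eqP dz] := cocycleP z.
apply/andP; split; first exact: pullback_cochain.
by rewrite coboundary_pullback dz raddf0.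
Qed.

Definition pullback_cocycle k (z : cocycles G H k) : cocycles G' H k :=
  Cocycle (pullback_cocycleP z).

Definition induced k (x : red_cohomology G H k) : red_cohomology G' H k :=
  \pi_(red_cohomology G' H k) (pullback_cocycle (repr x)).

(* [induced] does not depend on the representative cocycle. *)
Lemma induced_pi k (z : cocycles G H k) :
  induced (\pi_(red_cohomology G H k) z) =
  \pi_(red_cohomology G' H k) (pullback_cocycle z).
Proof.
rewrite /induced; apply/eqP; rewrite -Quotient.idealrBE.
have : repr (\pi_(red_cohomology G H k) z) - z \in @coboundaries G H k.
  by rewrite Quotient.idealrBE reprK.
move: (repr _) => y /asboolP hb; apply/asboolP.
case: k z y hb => [|j] z y /=.
  move=> [a ea]; exists a; rewrite -pullback_augmentation -ea.
  by rewrite raddfB.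
move=> [b hb eb]; exists (pullback b); first exact: pullback_cochain.
by rewrite coboundary_pullback -eb raddfB.
Qed.

End InducedMap.

Arguments induced {G G' H phi} phi_hom phi_inj k x.

(* A map from the two vertices of K_2 onto the edge {r, r+1} is injective. *)
Lemma edge_map_inj r (phi : vertex (complete_graph 2) -> vertex (cycle_graph r)) :
  (0 < r)%N ->
  phi @: [set: vertex (complete_graph 2)] = [set inord r; inord r.+1] ->
  injective phi.
Proof.
move=> r0 im; suff /imset_injP h : #|phi @: [set: vertex (complete_graph 2)]| ==
    #|[set: vertex (complete_graph 2)]|.
  by move=> x y; apply: h; rewrite inE.
have hr : (r < r.*2.+1)%N by rewrite ltnS -addnn leq_addr.
have hr1 : (r.+1 < r.*2.+1)%N.
  by rewrite ltnS -addnn -[X in (X < _)%N]add0n ltn_add2r.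
rewrite im cardsT card_ord cards2.
suff -> : inord r != inord r.+1 :> 'I_(r.*2.+1) by [].
by rewrite -val_eqE /= (inordK hr) (inordK hr1) -{1}[r]addn0 -addn1 eqn_add2l.
Qed.

(* Main.v *)
Require Import Defs.
From mathcomp Require Import all_boot all_order all_algebra.
From mathcomp Require Import ring_quotient boolp ring zify.

Set Implicit Arguments.
Unset Strict Implicit.
Unset Printing Implicit Defensive.

Import GRing.Theory.
Local Open Scope ring_scope.

(** Write [(x, y)^*] for the pullback along the homomorphism of K_2 onto the
    oriented edge (x, y) of the cycle. The maps given by (x, y) and (s, y) are
    homotopic: both land in the cell (eta x u eta s) x eta y. The flip of K_2
    is the antipodal map of the sphere Hom(K_2, K_n) of dimension n - 2, which
    acts by -1 on reduced cohomology when n is even. Hence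
    [(x, y)^* = (s, y)^* = - (y, s)^*] in cohomology, and going once around the
    odd cycle gives [(x, y)^* = - (x, y)^*]. *)

(** * Positions and inversions *)

(** Both facts behind these equalities are proved by explicit cochain formulas. For the flip, the
    cells of Hom(K_2, K_n) are the pairs of disjoint nonempty sets. Allowing empty sets as well
    gives all simplices of the boundary of a cross-polytope, including the empty one. This larger
    complex is a tensor power, so the homotopy between the swap and a sign can be written down; the
    price is that it leaves the cochains vanishing on the two added faces. These faces are disjoint
    except for the empty simplex, and that overlap is what makes degree 0 special. On the
    cross-polytope the swap acts by (-1)^n; passing to Hom(K_2, K_n) shifts the degree by one and
    contributes one more sign. For two edges with a common end, the homotopy is a join: on A x A' x
    B a cochain takes its value on the cell with factors A u A' and B, which is one dimension
    higher. The formulas live on K_2 and on a path with three vertices. Carrying them to the cycle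
    requires that pullbacks compose, reordering signs included. *)

Lemma signr_eq (m p : nat) : odd m = odd p -> (-1) ^+ m = (-1) ^+ p :> int.
Proof. by move=> e; rewrite -signr_odd e signr_odd. Qed.

Lemma signr_opp (m p : nat) : odd m != odd p -> (-1) ^+ m = - (-1) ^+ p :> int.
Proof.
move=> e; rewrite -[RHS]mulN1r -exprS; apply: signr_eq; move: e.
by rewrite oddS; do 2!case: (odd _).
Qed.

Lemma antisym_sum0 (T : finType) (f : T -> T -> int) :
  (forall x y, f y x = - f x y) -> \sum_x \sum_y f x y = 0.
Proof.
move=> h; set s := \sum_x _.
have : s = - s.
  rewrite {1}/s exchange_big /= -sumrN; apply: eq_bigr => x _.
  by rewrite -sumrN; apply: eq_bigr => y _.
lia.
Qed.

Lemma big_disjointU (R : Type) (idx : R) (op : Monoid.com_law idx)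
    (T : finType) (A B : {set T}) (F : T -> R) : [disjoint A & B] ->
  \big[op/idx]_(i in A :|: B) F i =
  op (\big[op/idx]_(i in A) F i) (\big[op/idx]_(i in B) F i).
Proof. by move=> d; rewrite -bigU //; apply: eq_bigl => i; rewrite !inE. Qed.

Section Positions.
Variable n : nat.
Implicit Types (A B : {set 'I_n}) (x y : 'I_n).

Definition pos A x := #|[set a in A | (a < x)%N]|.

Definition inversions A B := (\sum_(a in A) pos B a)%N.

Lemma pos_sum A x : pos A x = (\sum_(a in A) (a < x))%N.
Proof.
rewrite /pos -sum1_card [RHS]big_mkcond [LHS]big_mkcond; apply: eq_bigr => a _.
by rewrite inE; case: (a \in A) => //=; case: ltngtP.
Qed.

Lemma posD1 A x y : y \in A -> pos A x = (pos (A :\ y) x + (y < x))%N.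
Proof. by move=> yA; rewrite !pos_sum (big_setD1 y) //= addnC. Qed.

Lemma posU1 A x y : y \notin A -> pos (y |: A) x = (pos A x + (y < x))%N.
Proof. by move=> yA; rewrite (posD1 _ (setU11 _ _)) setU1K. Qed.

Lemma pos_self A x : pos (A :\ x) x = pos A x.
Proof.
case: (boolP (x \in A)) => [xA|xA]; first by rewrite (posD1 _ xA) ltnn addn0.
by congr pos; apply/setP => y; rewrite !inE; case: eqP => // ->; rewrite (negPf xA).
Qed.

Lemma posU A B x : [disjoint A & B] -> pos (A :|: B) x = (pos A x + pos B x)%N.
Proof. by move=> d; rewrite !pos_sum big_disjointU. Qed.

(** Trades the number of elements above x, which [inversionsDr] produces, for [pos A x] in parity
    computations. *)
Lemma card_pos A x :
  #|A| = (pos A x + \sum_(a in A) (x < a) + (x \in A))%N.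
Proof.
rewrite pos_sum -big_split /= -sum1_card.
case: (boolP (x \in A)) => xA; last first.
  rewrite addn0; apply: eq_bigr => a aA /=.
  by case: (ltngtP a x) => // /val_inj e; rewrite -e aA in xA.
rewrite (big_setD1 x) //= [in RHS](big_setD1 x) //= ltnn /= addnC; congr addn.
apply: eq_bigr => a; rewrite !inE => /andP[ax _].
by case: (ltngtP a x) => // /val_inj e; rewrite e eqxx in ax.
Qed.

Lemma inversionsDl A B x : x \in A ->
  inversions A B = (inversions (A :\ x) B + pos B x)%N.
Proof. by move=> xA; rewrite /inversions (big_setD1 x) //= addnC. Qed.

Lemma inversionsDr A B x : x \in B ->
  inversions A B = (inversions A (B :\ x) + \sum_(a in A) (x < a))%N.
Proof.
by move=> xB; rewrite /inversions -big_split; apply: eq_bigr => a _; exact: posD1.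
Qed.

Lemma inversions0r A : inversions A set0 = 0%N.
Proof. by rewrite /inversions big1 // => a _; rewrite pos_sum big_set0. Qed.

Lemma inversions0l B : inversions set0 B = 0%N.
Proof. exact: big_set0. Qed.

End Positions.

(** * The cross-polytope and its antipodal map *)

Lemma alternating_telescope (n : nat) (f : nat -> int) :
  \sum_(i < n) (-1) ^+ i * (f i + f i.+1) = f 0%N - (-1) ^+ n * f n.
Proof.
elim: n => [|n IHn]; first by rewrite big_ord0 expr0 mul1r subrr.
by rewrite big_ord_recr /= IHn exprS; ring.
Qed.

Section CrossPolytope.
Variable n : nat.
Implicit Types (A B : {set 'I_n}) (g : {set 'I_n} -> {set 'I_n} -> int).

(* For disjoint A and B, the pair (A, B) stands for the simplex of the
   cross-polytope with vertices +a, a in A, and -b, b in B, sorted by absolute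
   value; (set0, set0) is the empty simplex. *)
Definition cross_coboundary g A B : int :=
  \sum_(x in A :|: B) (-1) ^+ pos (A :|: B) x * g (A :\ x) (B :\ x).

Definition flip_below (i : nat) A B :=
  [set a : 'I_n | if (a < i)%N then a \in B else a \in A].

Definition insert_both g (i : 'I_n) A B : int := g (i |: A) B + g A (i |: B).

(* The augmented chain complex of the cross-polytope is the n-th tensor power
   of that of two points {+, -}, where the swap is homotopic to -1 by sending
   the empty simplex to (+) + (-). This is the induced homotopy on the tensor
   power, with the swap applied to the factors below i. *)
Definition cross_homotopy g A B : int :=
  \sum_(i | i \notin A :|: B) (-1) ^+ (i + pos (A :|: B) i) *
    insert_both g i (flip_below i A B) (flip_below i B A).

Lemma flip_belowU i A B : flip_below i A B :|: flip_below i B A = A :|: B.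
Proof. by apply/setP => a; rewrite !inE; case: ifP => //; rewrite orbC. Qed.

Lemma flip_belowD1 i A B x :
  flip_below i A B :\ x = flip_below i (A :\ x) (B :\ x).
Proof. by apply/setP => a; rewrite !inE; case: ifP. Qed.

Lemma flip_below0 A B : flip_below 0 A B = A.
Proof. by apply/setP => a; rewrite inE. Qed.

Lemma flip_below_all A B : flip_below n A B = B.
Proof. by apply/setP => a; rewrite inE ltn_ord. Qed.

Lemma flip_belowS (i : 'I_n) A B : i \notin A :|: B ->
  flip_below i.+1 A B = flip_below i A B.
Proof.
rewrite inE negb_or => /andP[/negPf iA /negPf iB].
apply/setP => a; rewrite !inE ltnS; case: (ltngtP a i) => // /val_inj ->.
by rewrite iA iB.
Qed.

(** Delete x and put it back on either side: the side it has under the flip below x recovers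
    threshold x, the opposite side gives threshold x + 1. *)
Lemma flip_belowS_in (x : 'I_n) A B : [disjoint A & B] -> x \in A ->
  [/\ x |: flip_below x (A :\ x) (B :\ x) = flip_below x A B,
      flip_below x (B :\ x) (A :\ x) = flip_below x B A,
      flip_below x (A :\ x) (B :\ x) = flip_below x.+1 A B &
      x |: flip_below x (B :\ x) (A :\ x) = flip_below x.+1 B A].
Proof.
move=> /disjointFr dAB xA; have xB := dAB _ xA.
by split; apply/setP => a; rewrite !inE ?ltnS;
  case: (ltngtP a x) => [h|h|/val_inj ->] /=;
  rewrite ?xA ?xB ?eqxx ?ltnn // -?val_eqE /=; case: ltngtP h.
Qed.

(** Deleting the inserted i gives [g A B] from each of the two insertions. Deleting another x
    commutes with inserting i, and its position shifts by one when i lies below x. *)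
Lemma insert_both_coboundary g (i : 'I_n) A B : i \notin A :|: B ->
  insert_both (cross_coboundary g) i A B =
  (-1) ^+ pos (A :|: B) i * (g A B *+ 2) +
  \sum_(x in A :|: B) (-1) ^+ (pos (A :|: B) x + (i < x)) *
     insert_both g i (A :\ x) (B :\ x).
Proof.
move=> iS; have /norP[iA iB] : ~~ ((i \in A) || (i \in B)) by rewrite -in_setU.
rewrite /insert_both /cross_coboundary [A :|: (_ |: _)]setUCA -[_ |: A :|: B]setUA.
rewrite !big_setU1 //=.
rewrite !posU1 // ltnn addn0 !setU1K //.
have e (C : {set _}) : i \notin C -> C :\ i = C.
  move=> iC; apply/setP => y; rewrite !inE; case: eqP => // ->.
  by rewrite (negPf iC).
rewrite !e // mulr2n mulrDr addrACA -big_split /=; congr (_ + _).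
apply: eq_bigr => x xS; rewrite -mulrDr posU1 //; congr (_ * (g _ _ + g _ _));
  by apply/setP => y; rewrite !inE; case: (eqVneq y i) => //= ->;
     rewrite andbT; apply/eqP => ex; rewrite ex xS in iS.
Qed.

(** The terms that insert i outside S and delete x in S occur in both summands with opposite signs.
    What remains, for every i below n, is [(-1) ^+ i * (f i + f i.+1)]: it comes from deleting the
    inserted i when i is outside S, and from reinserting the deleted i when i is in S. This
    alternating sum telescopes from the identity to the full swap. *)
Theorem cross_homotopyP g A B : [disjoint A & B] ->
  cross_coboundary (cross_homotopy g) A B +
  cross_homotopy (cross_coboundary g) A B = g A B - (-1) ^+ n * g B A.
Proof.
move=> dAB; set S := A :|: B.
pose f i := g (flip_below i A B) (flip_below i B A).
have -> : g A B - (-1) ^+ n * g B A =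
    \sum_(i < n) (-1) ^+ i * (f i + f i.+1).
  by rewrite alternating_telescope /f !flip_below0 !flip_below_all.
have -> : cross_homotopy (cross_coboundary g) A B =
    \sum_(i | i \notin S) ((-1) ^+ i * (f i + f i.+1) +
      \sum_(x in S) (-1) ^+ (i + pos S i + (pos S x + (i < x))) *
        insert_both g i (flip_below i (A :\ x) (B :\ x))
                        (flip_below i (B :\ x) (A :\ x))).
  apply: eq_bigr => i iS; rewrite insert_both_coboundary flip_belowU // -/S.
  rewrite mulrDr mulrA -exprD; congr (_ + _).
    (* As i lies in neither set, moving the threshold past i changes nothing: the doubled value is
       [f i + f i.+1]. *)
    rewrite /f !flip_belowS // -?mulr2n; last by rewrite setUC.
    by congr (_ * _); apply: signr_eq; rewrite !oddD -addbA addbb addbF.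
  rewrite mulr_sumr; apply: eq_bigr => x xS.
  by rewrite mulrA -exprD !flip_belowD1.
have -> : cross_coboundary (cross_homotopy g) A B =
    \sum_(x in S) ((-1) ^+ x * (f x + f x.+1) -
      \sum_(i | i \notin S) (-1) ^+ (i + pos S i + (pos S x + (i < x))) *
        insert_both g i (flip_below i (A :\ x) (B :\ x))
                        (flip_below i (B :\ x) (A :\ x))).
  apply: eq_bigr => x xS; rewrite /cross_homotopy -/S -setDUl -/S.
  rewrite (bigD1 x) /=; last by rewrite !inE eqxx.
  rewrite mulrDr; congr (_ + _).
    rewrite mulrA -exprD pos_self; congr (_ * _).
      by apply: signr_eq; rewrite !oddD addbCA addbb addbF.
    rewrite /insert_both /f; move: xS; rewrite inE.
    case: (boolP (x \in A)) => [xA _|_ /= xB].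
      by have [-> -> -> ->] := flip_belowS_in dAB xA.
    rewrite disjoint_sym in dAB.
    by have [-> -> -> ->] := flip_belowS_in dAB xB; rewrite addrC.
  rewrite mulr_sumr -sumrN; apply: eq_big => [i|i /andP[_ ix]].
    by rewrite [in LHS]inE in_set1; case: (eqVneq i x) => [->|_] /=; rewrite ?xS ?andbT.
  rewrite mulrA -exprD -mulNr; congr (_ * _); apply: signr_opp.
  rewrite (posD1 i xS) !oddD.
  by case: (ltngtP i x) ix => [_|_|/val_inj ->]; rewrite ?eqxx //=;
     do 3!case: (odd _).
rewrite !big_split /= sumrN [X in _ - X]exchange_big /= addrACA addNr addr0.
by rewrite [RHS](bigID (mem S)).
Qed.

Lemma cross_coboundaryK g A B : cross_coboundary (cross_coboundary g) A B = 0.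
Proof.
rewrite /cross_coboundary; set S := A :|: B.
pose t x y := if [&& x \in S, y \in S & x != y]
  then (-1) ^+ (pos S x + pos (S :\ x) y) * g (A :\ x :\ y) (B :\ x :\ y)
  else 0.
transitivity (\sum_x \sum_y t x y); last apply: antisym_sum0 => x y.
  rewrite [LHS]big_mkcond; apply: eq_bigr => x _; case: ifP => xS; last first.
    by rewrite big1 // => y _; rewrite /t xS.
  rewrite mulr_sumr -setDUl big_mkcond; apply: eq_bigr => y _.
  rewrite /t xS /= !inE eq_sym andbC.
  by case: ifP => // _; rewrite mulrA exprD.
rewrite /t eq_sym; case: (boolP (x \in S)) => xS; rewrite ?andbF ?oppr0 //.
case: (boolP (y \in S)) => yS; rewrite ?oppr0 //=.
case: (eqVneq x y) => xy; rewrite ?oppr0 //= -mulNr.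
congr (_ * _).
  apply: signr_opp; rewrite (posD1 y xS) (posD1 x yS) !oddD.
  by case: (ltngtP x y) xy => [_|_|/val_inj ->]; rewrite ?eqxx //=;
     do 2!case: (odd _).
by rewrite !setDDl ![[set x; y]]setUC.
Qed.

End CrossPolytope.

(** By disjointness, each pair in A x B is counted by exactly one of the two sums. *)
Lemma inversions_sym n (A B : {set 'I_n}) : [disjoint A & B] ->
  (inversions A B + inversions B A = #|A| * #|B|)%N.
Proof.
move=> dAB; rewrite /inversions.
under eq_bigr => a _ do rewrite pos_sum.
under [X in (_ + X)%N]eq_bigr => b _ do rewrite pos_sum.
rewrite [X in (_ + X)%N]exchange_big -big_split /= -sum_nat_const.
apply: eq_bigr => a aA; rewrite -big_split /= -sum1_card.
apply: eq_bigr => b bB /=.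
by case: (ltngtP a b) => // /val_inj e; rewrite e (disjointFl dAB bB) in aA.
Qed.

Lemma setD1_id (T : finType) (A : {set T}) x : x \notin A -> A :\ x = A.
Proof. by move=> xA; apply/setDidPl; rewrite disjoint_sym disjoints1. Qed.

(** * Degrees of cross-polytope cochains, and cones over the two opposite faces *)

Section Homogeneity.
Variable n : nat.
Implicit Types (A B : {set 'I_n}) (g : {set 'I_n} -> {set 'I_n} -> int).

(** The degree counts vertices: the empty simplex has degree 0, and a cell of dimension k of
    Hom(K_2, K_n) has degree k + 2. *)
Definition homogeneous (m : nat) g :=
  forall A B, [disjoint A & B] -> #|A :|: B| != m -> g A B = 0.

Lemma disjoint_flip_below i A B :
  [disjoint A & B] -> [disjoint flip_below i A B & flip_below i B A].
Proof.
move=> dAB; apply/pred0P => a; move: (pred0P dAB a); rewrite /= !inE.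
by case: ifP => // _; rewrite andbC.
Qed.

Lemma disjoint_setD1 A B x : [disjoint A & B] -> [disjoint A :\ x & B :\ x].
Proof.
by move=> dAB; apply: disjointWl (subD1set _ _) _; apply: disjointWr (subD1set _ _) _.
Qed.

Lemma disjoint_insert A B i : i \notin A :|: B -> [disjoint A & B] ->
  [disjoint i |: A & B] /\ [disjoint A & i |: B].
Proof.
rewrite inE => /norP[iA iB] dAB.
split; rewrite -setI_eq0 ?setIUl ?setIUr setU_eq0 !setI_eq0 dAB ?andbT /=.
  by rewrite disjoints1.
by rewrite disjoint_sym disjoints1.
Qed.

(** Every value of g in the formula is taken on a disjoint pair with exactly one more vertex. This
    serves both to track degrees and to discard the homotopy of a vanishing coboundary. *)
Lemma cross_homotopy0 g A B :
  (forall A' B', [disjoint A' & B'] -> #|A' :|: B'| = #|A :|: B|.+1 -> g A' B' = 0) ->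
  [disjoint A & B] -> cross_homotopy g A B = 0.
Proof.
move=> g0 dAB; rewrite /cross_homotopy big1 // => i iS; rewrite /insert_both.
have iS' : i \notin flip_below i A B :|: flip_below i B A by rewrite flip_belowU.
have [d1 d2] := disjoint_insert iS' (disjoint_flip_below i dAB).
have c : #|i |: (A :|: B)| = #|A :|: B|.+1 by rewrite cardsU1 iS.
rewrite !g0 ?addr0 ?mulr0 //; first by rewrite setUCA flip_belowU.
by rewrite -setUA flip_belowU.
Qed.

Lemma homogeneous_cross_homotopy m g :
  homogeneous m.+1 g -> homogeneous m (cross_homotopy g).
Proof.
by move=> hg A B dAB hm; apply: cross_homotopy0 => // A' B' d e; rewrite hg // e eqSS.
Qed.

Lemma homogeneous_cross_coboundary m g :
  homogeneous m g -> homogeneous m.+1 (cross_coboundary g).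
Proof.
move=> hg A B dAB hm; rewrite /cross_coboundary big1 // => x xS.
rewrite hg ?mulr0 ?disjoint_setD1 // -setDUl; move: hm.
by rewrite (cardsD1 x (A :|: B)) xS add1n eqSS.
Qed.

Lemma cross_coboundary_tr g A B :
  cross_coboundary (fun A B => g B A) A B = cross_coboundary g B A.
Proof. by rewrite /cross_coboundary setUC. Qed.

Section Cone.
Variable o : 'I_n.
Hypothesis o_min : forall x : 'I_n, (o <= x)%N.

Lemma pos_min A : pos A o = 0%N.
Proof. by rewrite pos_sum big1 // => a _; rewrite ltnNge o_min. Qed.

Lemma lt_min (x : 'I_n) : x != o -> (o < x)%N.
Proof. by rewrite ltn_neqAle o_min andbT eq_sym. Qed.

(* On the two faces A = set0 and B = set0, a cone with apex o; the value at
   (set0, set0) is the one suiting the face B = set0. *)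
Definition cone g A B : int :=
  if B == set0 then if o \in A then 0 else g (o |: A) set0
  else if A == set0 then if o \in B then 0 else g set0 (o |: B)
  else 0.

Lemma homogeneous_cone m g : homogeneous m.+1 g -> homogeneous m (cone g).
Proof.
move=> hg A B dAB; rewrite /cone.
case: (eqVneq B set0) => [-> |_]; last case: (eqVneq A set0) => // ->;
  rewrite ?setU0 ?set0U => hm.
  case: ifPn => // oA; apply: (hg); first by rewrite -setI_eq0 setI0.
  by rewrite setU0 cardsU1 oA.
case: ifPn => // oB; apply: hg; first by rewrite -setI_eq0 set0I.
by rewrite set0U cardsU1 oB.
Qed.

(** If o is in A, the cone vanishes on the facets through o, and the facet omitting o has sign +1
    because o is least. Otherwise the relation on [o |: A] expresses [g A set0] through the facets
    containing o, whose values are those of the cone on the facets of A. *)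
Lemma cone_face g A : A != set0 -> cross_coboundary g (o |: A) set0 = 0 ->
  cross_coboundary (cone g) A set0 = g A set0.
Proof.
move=> A0; rewrite /cross_coboundary !setU0.
case: (boolP (o \in A)) => oA.
  move=> _; rewrite (big_setD1 o) //= pos_min mul1r set0D big1 ?addr0.
    by rewrite /cone eqxx !inE eqxx /= setD1K.
  move=> x; rewrite !inE => /andP[xo xA].
  by rewrite /cone set0D eqxx !inE eq_sym xo oA mulr0.
rewrite big_setU1 //= pos_min mul1r setU1K // set0D => /eqP.
rewrite addr_eq0 => /eqP ->; rewrite -sumrN; apply: eq_bigr => x xA.
have xo : x != o by apply: contraNneq oA => <-.
rewrite posU1 // set0D /cone eqxx !inE (negPf oA) andbF -mulNr.
have -> : (o |: A) :\ x = o |: A :\ x.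
  by rewrite setDUl (@setD1_id _ [set o]) ?inE.
congr (_ * _); apply: signr_opp.
by rewrite oddD lt_min // addbT; case: (odd _).
Qed.

(** The bound on B keeps its facets away from the empty simplex, where the cone takes the value
    chosen for the other face. *)
Lemma cone_face_tr g B : (1 < #|B|)%N -> cross_coboundary g set0 (o |: B) = 0 ->
  cross_coboundary (cone g) set0 B = g set0 B.
Proof.
move=> B1; rewrite -cross_coboundary_tr => /cone_face.
rewrite -card_gt0 ltnW // => /(_ isT) <-.
rewrite /cross_coboundary set0U setU0; apply: eq_bigr => x xB; congr (_ * _).
rewrite set0D /cone eqxx; case: eqP => // e; move: B1.
by rewrite (cardsD1 x B) xB e cards0.
Qed.

Lemma cone_face1 g (x : 'I_n) :
  cross_coboundary (cone g) set0 [set x] = g [set o] set0.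
Proof.
rewrite /cross_coboundary set0U big_set1 set0D setDv /cone eqxx inE setU0.
suff -> : pos [set x] x = 0%N by rewrite mul1r.
by rewrite pos_sum big_set1 ltnn.
Qed.

Lemma cross_coboundary_edge g (x : 'I_n) : x != o ->
  cross_coboundary g set0 [set o; x] = g set0 [set x] - g set0 [set o].
Proof.
move=> xo; rewrite /cross_coboundary set0U big_setU1 ?inE 1?eq_sym //= big_set1.
rewrite !set0D pos_min mul1r setU1K ?inE 1?eq_sym // setUC setU1K ?inE //.
suff -> : pos [set x; o] x = 1%N by rewrite expr1 mulN1r.
by rewrite posU1 ?inE // ltnn pos_sum big_set1 lt_min.
Qed.

Lemma cone_correction g : (forall A B, A :&: B = set0 -> (A == set0) || (B == set0) ->
    cross_coboundary g A B = 0) ->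
  let g' A B := g A B - cross_coboundary (cone g) A B in
  (forall A, A != set0 -> g' A set0 = 0) /\
  (forall B, B != set0 -> g' set0 B =
     if #|B| == 1%N then g set0 [set o] - g [set o] set0 else 0).
Proof.
move=> dg /=; split=> [A A0|B B0].
  by rewrite cone_face ?subrr // dg ?eqxx ?orbT // setI0.
case: ifPn => [/cards1P[x ->]|B1].
  (* The relation on the edge {o, x} makes g equal at its two ends, so the defect is the same at
     every vertex of this face. *)
  rewrite cone_face1; congr (_ - _); case: (eqVneq x o) => [-> //|xo].
  apply/eqP; rewrite -subr_eq0 -cross_coboundary_edge //.
  by rewrite dg ?eqxx // set0I.
rewrite cone_face_tr ?subrr //; last by rewrite dg ?eqxx // set0I.
by case: #|B| B1 (card_gt0 B) => [|[|]] //; rewrite B0.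
Qed.

End Cone.
End Homogeneity.

(** * The flip on Hom(K_2, K_n) *)

Section EdgeComplex.
Variable n : nat.
Notation K2 := (complete_graph 2).
Notation Kn := (complete_graph n).
Implicit Types (A B : {set 'I_n}) (c z : cochains K2 Kn).

Definition cell2 A B : setfun K2 Kn :=
  [ffun v : 'I_2 => if v == ord0 then A else B].

Lemma cell2_0 A B : cell2 A B (ord0 : 'I_2) = A.
Proof. by rewrite ffunE. Qed.

Lemma cell2_1 A B : cell2 A B (ord_max : 'I_2) = B.
Proof. by rewrite ffunE. Qed.

Lemma ord2P (P : 'I_2 -> Prop) : P ord0 -> P ord_max -> forall v, P v.
Proof.
move=> P0 P1 v; case: (unliftP ord0 v) => [w|] -> //.
suff -> : lift ord0 w = ord_max by [].
by apply/val_inj; rewrite /= (ord1 w).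
Qed.

Lemma cell2_ind (P : setfun K2 Kn -> Prop) :
  (forall A B, P (cell2 A B)) -> forall eta, P eta.
Proof.
move=> PAB eta; have -> // : eta = cell2 (eta (ord0 : 'I_2)) (eta (ord_max : 'I_2)).
by apply/ffunP; apply: ord2P; rewrite ?cell2_0 ?cell2_1.
Qed.

Lemma big_ord2 (R : Type) (idx : R) (op : Monoid.law idx) (F : 'I_2 -> R) :
  \big[op/idx]_(v < 2) F v = op (F ord0) (F ord_max).
Proof. by rewrite big_ord_recl big_ord1; congr (op _ (F _)); exact: val_inj. Qed.

Lemma adjacent_disjoint A B :
  [forall a in A, forall b in B, (a != b :> 'I_n)] = [disjoint A & B].
Proof.
apply/idP/idP => [/forall_inP h|dAB].
  apply/pred0P => a /=; apply/negP => /andP[aA aB].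
  by have /forall_inP/(_ a aB) := h a aA; rewrite eqxx.
apply/forall_inP => a aA; apply/forall_inP => b bB.
by apply: contraTneq aA => ->; rewrite (disjointFl dAB bB).
Qed.

Lemma is_cell2 A B :
  is_cell (cell2 A B) = [&& A != set0, B != set0 & [disjoint A & B]].
Proof.
apply/andP/and3P => [[/forallP h0 /forallP h1]|[A0 B0 dAB]].
  split; first by rewrite -(cell2_0 A B).
    by rewrite -(cell2_1 A B).
  have /forallP/(_ (ord_max : 'I_2))/implyP/(_ isT) := h1 (ord0 : 'I_2).
  by rewrite cell2_0 cell2_1 adjacent_disjoint.
split; first by apply/forallP; apply: ord2P; rewrite ?cell2_0 ?cell2_1.
apply/forallP; apply: ord2P; apply/forallP; apply: ord2P => //=;
  rewrite ?cell2_0 ?cell2_1 adjacent_disjoint //.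
by rewrite disjoint_sym.
Qed.

Lemma celldim_cell2 A B : celldim (cell2 A B) = (#|A|.-1 + #|B|.-1)%N.
Proof. by rewrite /celldim big_ord2 cell2_0 cell2_1. Qed.

Lemma facet_cell2_0 A B w : facet (cell2 A B) (ord0 : 'I_2) w = cell2 (A :\ w) B.
Proof. by apply/ffunP; apply: ord2P; rewrite !ffunE. Qed.

Lemma facet_cell2_1 A B w : facet (cell2 A B) (ord_max : 'I_2) w = cell2 A (B :\ w).
Proof. by apply/ffunP; apply: ord2P; rewrite !ffunE. Qed.

Lemma facet_sign_cell2_0 A B w :
  facet_sign (cell2 A B) (ord0 : 'I_2) w = pos A w.
Proof. by rewrite /facet_sign big_pred0 ?add0n ?cell2_0. Qed.

Lemma facet_sign_cell2_1 A B w :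
  facet_sign (cell2 A B) (ord_max : 'I_2) w = (#|A|.-1 + pos B w)%N.
Proof.
by rewrite /facet_sign big_mkcond big_ord2 /= addn0 cell2_0 cell2_1.
Qed.

Lemma cochain_noncell k c A B :
  cochain k c -> ~~ is_cell (cell2 A B) -> c (cell2 A B) = 0.
Proof. by move=> /cochainP hc hAB; apply: hc; rewrite (negPf hAB). Qed.

(** Meant for cochains: removing the only vertex of a factor leaves no cell, so the extra term is
    zero. *)
Lemma drop_card_guard A (F : 'I_n -> int) :
  (forall w, A = [set w] -> F w = 0) ->
  \sum_(w in A | (1 < #|A|)%N) F w = \sum_(w in A) F w.
Proof.
move=> F0; case: ltnP => A1; first by apply: eq_bigl => w; rewrite andbT.
rewrite big_pred0 => [|w]; last by rewrite andbF.
rewrite big1 // => w wA; apply: F0; apply/eqP.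
by rewrite eq_sym eqEcard sub1set wA cards1.
Qed.

Lemma coboundary_cell2 k c A B : cochain k c -> is_cell (cell2 A B) ->
  coboundary c (cell2 A B) =
  \sum_(w in A) (-1) ^+ pos A w * c (cell2 (A :\ w) B) +
  \sum_(w in B) (-1) ^+ (#|A|.-1 + pos B w) * c (cell2 A (B :\ w)).
Proof.
move=> hc hAB; rewrite ffunE hAB big_ord2 cell2_0 cell2_1.
rewrite !drop_card_guard => [|w eB|w eA].
- congr (_ + _); apply: eq_bigr => w _.
    by rewrite facet_sign_cell2_0 facet_cell2_0.
  by rewrite facet_sign_cell2_1 facet_cell2_1.
- rewrite facet_cell2_1 (cochain_noncell hc) ?mulr0 //.
  by rewrite is_cell2 eB setDv eqxx andbF.
- rewrite facet_cell2_0 (cochain_noncell hc) ?mulr0 //.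
  by rewrite is_cell2 eA setDv eqxx.
Qed.

(* The cell A x B of Hom(K_2, K_n) corresponds to the simplex (A, B) of the
   cross-polytope, of dimension higher by one; the sign accounts for this shift
   and for sorting the vertices by absolute value. *)
Definition cross_sign A B : int := (-1) ^+ (#|B| + inversions A B).

Definition to_cross c A B : int := cross_sign A B * c (cell2 A B).

Definition of_cross g : cochains K2 Kn :=
  [ffun eta : setfun K2 Kn =>
     if is_cell eta then
       cross_sign (eta (ord0 : 'I_2)) (eta (ord_max : 'I_2)) *
         g (eta (ord0 : 'I_2)) (eta (ord_max : 'I_2))
     else 0].

Lemma cross_signK A B (a : int) : cross_sign A B * (cross_sign A B * a) = a.
Proof. by rewrite mulrA -exprD -signr_odd addnn odd_double mul1r. Qed.

Lemma to_crossK g A B : is_cell (cell2 A B) -> to_cross (of_cross g) A B = g A B.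
Proof.
by move=> hAB; rewrite /to_cross ffunE hAB cell2_0 cell2_1 cross_signK.
Qed.

(** For x in A, the [pos B x] lost inversions match the elements of B sorted before x. For x in B,
    the lost inversions are the elements of A above x; with the drop of [#|B|] by one they turn
    [pos A x] into [#|A|.-1] modulo 2. *)
Lemma cross_coboundary_to_cross k c A B : cochain k c -> is_cell (cell2 A B) ->
  cross_coboundary (to_cross c) A B = cross_sign A B * coboundary c (cell2 A B).
Proof.
move=> hc hAB; rewrite (coboundary_cell2 hc) //.
move: hAB; rewrite is_cell2 -!card_gt0 => /and3P[A0 B0 dAB].
rewrite /cross_coboundary big_disjointU // mulrDr !mulr_sumr.
congr (_ + _); apply: eq_bigr => x xX; rewrite /to_cross !mulrA -!exprD posU //.
  have xB : x \notin B by rewrite (disjointFr dAB xX).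
  rewrite [B :\ x]setD1_id //; congr (_ * _); apply: signr_eq.
  rewrite (inversionsDl B xX) !oddD; do 5!case: (odd _) => //.
have xA : x \notin A by rewrite (disjointFl dAB xX).
rewrite [A :\ x]setD1_id //; congr (_ * _); apply: signr_eq.
rewrite (inversionsDr A xX) !oddD -subn1 oddB // (card_pos A x) (negPf xA).
rewrite (cardsD1 x B) xX !oddD /=.
by do 5!case: (odd _).
Qed.

Lemma to_cross0 k c A B : cochain k c -> (A == set0) || (B == set0) ->
  to_cross c A B = 0.
Proof.
move=> hc AB0; rewrite /to_cross (cochain_noncell hc) ?mulr0 //.
by rewrite is_cell2; case/orP: AB0 => ->; rewrite ?andbF.
Qed.

(** [to_cross] extends z by zero to the pairs with an empty set. These are closed under deleting
    vertices, so the relation also holds there. *)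
Lemma cross_cocycle k z A B : z \in cocycle k -> [disjoint A & B] ->
  cross_coboundary (to_cross z) A B = 0.
Proof.
move=> /andP[hz /eqP dz] dAB; case: (boolP (is_cell (cell2 A B))) => hAB.
  by rewrite (cross_coboundary_to_cross hz) // dz ffunE mulr0.
move: hAB; rewrite is_cell2 dAB andbT negb_and !negbK => AB0.
rewrite /cross_coboundary big1 // => x _; rewrite (to_cross0 hz) ?mulr0 //.
by case/orP: AB0 => /eqP ->; rewrite set0D eqxx ?orbT.
Qed.

Lemma homogeneous_to_cross k c : cochain k c -> homogeneous k.+2 (to_cross c).
Proof.
move=> hc A B dAB hm; rewrite /to_cross.
case: (boolP (is_cell (cell2 A B))) => hAB; last by rewrite (cochain_noncell hc) ?mulr0.
move/cochainP: hc => ->; rewrite ?mulr0 // hAB celldim_cell2 /=.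
move: hAB hm; rewrite is_cell2 -!card_gt0 cardsU.
move=> /and3P[A0 B0]; rewrite -setI_eq0 => /eqP ->; rewrite cards0 subn0.
apply: contra => /eqP <-; case: #|A| A0 => //= a _.
by case: #|B| B0 => //= b _; rewrite addnS.
Qed.

Lemma cochain_of_cross k g : homogeneous k.+2 g -> cochain k (of_cross g).
Proof.
move=> hg; apply/cochainP; apply: cell2_ind => A B.
rewrite ffunE cell2_0 cell2_1 celldim_cell2.
case: (boolP (is_cell _)) => //=.
rewrite is_cell2 -!card_gt0 => /and3P[A0 B0 dAB] hk.
rewrite hg ?mulr0 //; move: hk; apply: contra; rewrite cardsU.
move: (dAB); rewrite -setI_eq0 => /eqP ->; rewrite cards0 subn0.
by case: #|A| A0 => //= a _; case: #|B| B0 => //= b _; rewrite addnS addSn !eqSS.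
Qed.

Definition swap : vertex K2 -> vertex K2 := @rev_ord 2.

Lemma swap_inj : injective swap.
Proof. exact: rev_ord_inj. Qed.

Lemma pull_swap A B : pull_cell swap (cell2 A B) = cell2 B A.
Proof. by apply/ffunP; apply: ord2P; rewrite !ffunE. Qed.

(** With a = [#|A|] and b = [#|B|], reordering the factors costs (a - 1)(b - 1), while the two cross
    signs together cost a + b + ab by [inversions_sym]. The exponents differ by an odd number, hence
    the minus sign. *)
Lemma pullback_swap c A B : is_cell (cell2 A B) ->
  pullback swap c (cell2 A B) = - cross_sign A B * to_cross c B A.
Proof.
move=> hAB; rewrite ffunE hAB pull_swap !celldim_cell2 addnC eqxx /=.
rewrite /to_cross [RHS]mulrA; congr (_ * _); rewrite mulNr /cross_sign -exprD.
apply: signr_opp; rewrite /reorder_sign.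
rewrite big_ord2 [X in odd (_ + X) != _]big_pred0 ?addn0; last exact: ord2P.
rewrite big_mkcond big_ord2 /= add0n.
move: hAB; rewrite is_cell2 -!card_gt0 => /and3P[A0 B0 dAB].
have := congr1 odd (inversions_sym dAB); rewrite !ffunE /= oddM.
case: #|A| A0 => // a _; case: #|B| B0 => //= b _.
by rewrite !oddD !oddM !oddS; do 4!case: (odd _).
Qed.

(* The cochains of Hom(K_2, K_n) are those of the cross-polytope that vanish
   on the faces A = set0 and B = set0. The homotopy does not preserve this
   condition, which is restored by a cone over each of the two faces, up to a
   constant on the vertices of one of them; in degree 0 this constant yields a
   coboundary of degree -1. *)
Theorem swap_cocycle k z : (0 < n)%N -> ~~ odd n -> z \in cocycle k ->
  is_reduced_coboundary k (z + pullback swap z).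
Proof.
move=> n0 n_even hz; have /andP[cz dz] := hz.
pose o : 'I_n := Ordinal n0.
pose g := to_cross z; pose y := cross_homotopy g.
have hy : homogeneous k.+1 y.
  by apply: homogeneous_cross_homotopy; exact: homogeneous_to_cross.
have dy A B : [disjoint A & B] -> cross_coboundary y A B = g A B - g B A.
  move=> dAB; have := cross_homotopyP g dAB.
  (* This summand is the homotopy applied to the coboundary of g, which vanishes since z is a
     cocycle. *)
  rewrite [cross_homotopy _ _ _]cross_homotopy0 //; last first.
    by move=> A' B' d _; exact: cross_cocycle hz d.
  by rewrite addr0 -signr_odd (negPf n_even) mul1r.
pose y' A B := y A B - cross_coboundary (cone o y) A B.
have hy' : homogeneous k.+1 y'.
  have hc := homogeneous_cross_coboundary (@homogeneous_cone n o _ _ hy).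
  by move=> A B dAB hm; rewrite /y' hy // hc // subrr.
have [||y'l y'r] := @cone_correction n o _ y => [x //|A B AB0 AB|].
  rewrite dy -?setI_eq0 ?AB0 // /g !(to_cross0 cz) ?subrr //.
  by rewrite orbC.
have dy' A B : [disjoint A & B] -> cross_coboundary y' A B = g A B - g B A.
  move=> dAB; rewrite -dy // -[RHS]subr0.
  rewrite -[X in _ - X](cross_coboundaryK (cone o y) A B) /cross_coboundary -sumrB.
  by apply: eq_bigr => x _; rewrite mulrBr.
have zE A B : is_cell (cell2 A B) -> (z + pullback swap z) (cell2 A B) =
    cross_sign A B * cross_coboundary y' A B.
  move=> hAB; have /and3P[_ _ dAB] : [&& A != set0, B != set0 & [disjoint A & B]].
    by rewrite -is_cell2.
  by rewrite dy' // mulrBr cross_signK ffunE pullback_swap // mulNr.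
have /cochainP cz0 := cz; have /cochainP cs0 := pullback_cochain swap cz.
case: k hz cz hy hy' cz0 cs0 {dz} => [|j] hz cz hy hy' cz0 cs0 /=.
  (* This is the opposite of the constant in [cone_correction]: on a pair of points, [cross_sign]
     contributes an extra minus. *)
  exists (y [set o] set0 - y set0 [set o]); apply/ffunP => eta.
  rewrite [RHS]ffunE; case: ifPn; last first.
    by move=> he; rewrite ffunE cz0 // cs0.
  elim/cell2_ind: eta => A B /andP[hAB].
  rewrite zE // celldim_cell2 addn_eq0.
  move: hAB; rewrite is_cell2 -!card_gt0 => /and3P[A0 B0 dAB] /andP[A1 B1].
  have /cards1P[a eA] : #|A| == 1%N by case: #|A| A0 A1 => [|[]].
  have /cards1P[b eB] : #|B| == 1%N by case: #|B| B0 B1 => [|[]].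
  have ab : a != b by move: dAB; rewrite eA eB disjoints1 inE.
  rewrite /cross_coboundary eA eB big_setU1 ?inE //= big_set1 !setDv.
  rewrite !setD1_id ?inE // 1?eq_sym //.
  rewrite (y'l : forall A, A != set0 -> y' A set0 = 0) -?card_gt0 ?cards1 //.
  rewrite (y'r : forall B, B != set0 -> y' set0 B = _) -?card_gt0 ?cards1 //.
  rewrite eqxx mulr0 addr0 /cross_sign /inversions big_set1 cards1.
  rewrite posU1 ?inE // ltnn addn0 mulrA -exprD -addnA addnn.
  by rewrite -signr_odd oddD odd_double expr1 mulN1r opprB.
(* In positive degree y lives on simplices with at least two vertices, so the constant left on
   single vertices is zero. *)
have y'0 A B : [disjoint A & B] -> (A == set0) || (B == set0) ->
    A :|: B != set0 -> y' A B = 0.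
  move=> dAB; case: (eqVneq B set0) => [->|B0]; first by rewrite setU0 => _ /y'l.
  rewrite orbF => /eqP A0; rewrite A0 set0U => _; rewrite /y' y'r //.
  case: ifP => // _; rewrite !hy ?subrr // ?setU0 ?set0U ?cards1 //.
    by rewrite -setI_eq0 setI0.
  by rewrite -setI_eq0 set0I.
have cb : cochain j (of_cross y') by apply: cochain_of_cross.
exists (of_cross y') => //; apply/ffunP => eta.
case: (boolP (is_cell eta)); last first.
  by move=> /negPf he; rewrite ffunE cz0 ?he // cs0 ?he // ffunE he addr0.
elim/cell2_ind: eta => A B hAB; rewrite zE //.
rewrite -[RHS](cross_signK A B) -(cross_coboundary_to_cross cb) //; congr (_ * _).
move: hAB; rewrite is_cell2 -!card_gt0 => /and3P[A0 B0 dAB].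
apply: eq_bigr => x xS; congr (_ * _).
have d : [disjoint A :\ x & B :\ x] by exact: disjoint_setD1.
case: (boolP (is_cell (cell2 (A :\ x) (B :\ x)))) => hc; first by rewrite to_crossK.
rewrite /to_cross (cochain_noncell cb) // mulr0 y'0 //.
  by move: hc; rewrite is_cell2 d andbT negb_and !negbK.
rewrite -setDUl -card_gt0; move: (cardsD1 x (A :|: B)); rewrite xS cardsU.
move: dAB; rewrite -setI_eq0 => /eqP ->; rewrite cards0 subn0.
by case: #|_ :\ _| => // e; move: A0 B0 e; lia.
Qed.

End EdgeComplex.

(** * Two edges with a common end *)

(** The centre is the last vertex, so that both legs preserve the order of the factors and carry no
    sign; see [reorder_sign_leg]. *)
Definition fork_edge (x y : 'I_3) : bool := (x == ord_max) != (y == ord_max).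

Lemma fork_sym : symmetric fork_edge.
Proof. by move=> x y; rewrite /fork_edge eq_sym. Qed.

Definition fork := Graph fork_sym.

Definition mid3 : 'I_3 := Ordinal (isT : 1 < 3)%N.

Definition leg (e : 'I_3) (v : vertex (complete_graph 2)) : vertex fork :=
  if v == ord0 :> 'I_2 then e else ord_max.

Lemma leg_inj e : e != ord_max -> injective (leg e).
Proof.
move=> e2; apply: ord2P; apply: ord2P; rewrite /leg //= => /eqP.
  by rewrite (negPf e2).
by rewrite eq_sym (negPf e2).
Qed.

Lemma ord3P (P : 'I_3 -> Prop) : P ord0 -> P mid3 -> P ord_max -> forall v, P v.
Proof.
by move=> P0 P1 P2 [[|[|[|//]]] i]; [move: P0|move: P1|move: P2];
  congr P; exact: val_inj.
Qed.

Lemma big_ord3 (R : Type) (idx : R) (op : Monoid.law idx) (F : 'I_3 -> R) :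
  \big[op/idx]_(v < 3) F v = op (F ord0) (op (F mid3) (F ord_max)).
Proof.
by rewrite big_ord_recl big_ord2; congr (op _ (op (F _) (F _))); exact: val_inj.
Qed.

Section ForkComplex.
Variable n : nat.
Notation K2 := (complete_graph 2).
Notation Kn := (complete_graph n).
Implicit Types (A B : {set 'I_n}) (c z : cochains K2 Kn).

Definition cell3 A A' B : setfun fork Kn :=
  [ffun v : 'I_3 => nth set0 [:: A; A'; B] v].

Lemma cell3_ind (P : setfun fork Kn -> Prop) :
  (forall A A' B, P (cell3 A A' B)) -> forall eta, P eta.
Proof.
move=> PAB eta.
have -> // : eta = cell3 (eta (ord0 : 'I_3)) (eta mid3) (eta (ord_max : 'I_3)).
by apply/ffunP; apply: ord3P; rewrite ffunE.
Qed.

Lemma cell3_0 A A' B : cell3 A A' B (ord0 : 'I_3) = A.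
Proof. by rewrite ffunE. Qed.

Lemma cell3_1 A A' B : cell3 A A' B mid3 = A'.
Proof. by rewrite ffunE. Qed.

Lemma cell3_2 A A' B : cell3 A A' B (ord_max : 'I_3) = B.
Proof. by rewrite ffunE. Qed.

Definition cell3E := (cell3_0, cell3_1, cell3_2).

Lemma is_cell3 A A' B : is_cell (cell3 A A' B) =
  [&& A != set0, A' != set0, B != set0, [disjoint A & B] & [disjoint A' & B]].
Proof.
apply/andP/and5P => [[/forallP h0 /forallP h1]|[A0 A'0 B0 dAB dA'B]].
  have hd v : fork_edge v ord_max ->
      [disjoint cell3 A A' B v & cell3 A A' B (ord_max : 'I_3)].
    move=> e; rewrite -adjacent_disjoint.
    by have /forallP/(_ (ord_max : 'I_3))/implyP/(_ e) := h1 v.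
  split; [by rewrite -(cell3_0 A A' B)|by rewrite -(cell3_1 A A' B)
         |by rewrite -(cell3_2 A A' B)| |].
    by have := hd ord0 isT; rewrite !cell3E.
  by have := hd mid3 isT; rewrite !cell3E.
split; first by apply/forallP; apply: ord3P; rewrite ?cell3E.
apply/forallP; apply: ord3P; apply/forallP; apply: ord3P => //=;
  rewrite ?cell3E adjacent_disjoint //.
  by rewrite disjoint_sym.
by rewrite disjoint_sym.
Qed.

Lemma celldim_cell3 A A' B :
  celldim (cell3 A A' B) = (#|A|.-1 + (#|A'|.-1 + #|B|.-1))%N.
Proof. by rewrite /celldim big_ord3 !cell3E. Qed.

Lemma facet_cell3_0 A A' B w :
  facet (cell3 A A' B) (ord0 : 'I_3) w = cell3 (A :\ w) A' B.
Proof. by apply/ffunP; apply: ord3P; rewrite !ffunE. Qed.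

Lemma facet_cell3_1 A A' B w : facet (cell3 A A' B) mid3 w = cell3 A (A' :\ w) B.
Proof. by apply/ffunP; apply: ord3P; rewrite !ffunE. Qed.

Lemma facet_cell3_2 A A' B w :
  facet (cell3 A A' B) (ord_max : 'I_3) w = cell3 A A' (B :\ w).
Proof. by apply/ffunP; apply: ord3P; rewrite !ffunE. Qed.

Lemma facet_sign_cell3_0 A A' B w :
  facet_sign (cell3 A A' B) (ord0 : 'I_3) w = pos A w.
Proof. by rewrite /facet_sign big_pred0 ?add0n ?cell3E. Qed.

Lemma facet_sign_cell3_1 A A' B w :
  facet_sign (cell3 A A' B) mid3 w = (#|A|.-1 + pos A' w)%N.
Proof. by rewrite /facet_sign big_mkcond big_ord3 /= !addn0 !cell3E. Qed.

Lemma facet_sign_cell3_2 A A' B w :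
  facet_sign (cell3 A A' B) (ord_max : 'I_3) w = (#|A|.-1 + #|A'|.-1 + pos B w)%N.
Proof. by rewrite /facet_sign big_mkcond big_ord3 /= !addn0 !cell3E. Qed.

Lemma pull_leg0 A A' B : pull_cell (leg ord0) (cell3 A A' B) = cell2 A B.
Proof. by apply/ffunP; apply: ord2P; rewrite !ffunE. Qed.

Lemma pull_leg1 A A' B : pull_cell (leg mid3) (cell3 A A' B) = cell2 A' B.
Proof. by apply/ffunP; apply: ord2P; rewrite !ffunE. Qed.

Lemma reorder_sign_leg e (eta : setfun fork Kn) : reorder_sign (leg e) eta = 0%N.
Proof.
rewrite /reorder_sign big1 // => u _; rewrite big1 // => v.
move: u v; apply: ord2P; apply: ord2P; rewrite //= /leg /=.
by rewrite ltnNge -ltnS ltn_ord.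
Qed.

Lemma pullback_leg0 c A A' B : is_cell (cell3 A A' B) ->
  pullback (leg ord0) c (cell3 A A' B) = if #|A'| == 1%N then c (cell2 A B) else 0.
Proof.
move=> hc; rewrite ffunE hc pull_leg0 reorder_sign_leg mul1r celldim_cell2 celldim_cell3.
move: hc; rewrite is_cell3 -!card_gt0 => /and5P[_ A'0 _ _ _].
rewrite addnCA -[X in X == _]add0n eqn_add2r /=.
by case: #|A'| A'0 => [|[]].
Qed.

Lemma pullback_leg1 c A A' B : is_cell (cell3 A A' B) ->
  pullback (leg mid3) c (cell3 A A' B) = if #|A| == 1%N then c (cell2 A' B) else 0.
Proof.
move=> hc; rewrite ffunE hc pull_leg1 reorder_sign_leg mul1r celldim_cell2 celldim_cell3.
move: hc; rewrite is_cell3 -!card_gt0 => /and5P[A0 _ _ _ _].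
rewrite -[X in X == _]add0n eqn_add2r /=.
by case: #|A| A0 => [|[]].
Qed.

(* The value of a cochain on the cell (A * A') x B, where A * A' is the join
   inside the simplex on 'I_n, degenerate if A and A' meet. *)
Definition join_value c A A' B : int :=
  (-1) ^+ (#|A| + inversions A A') *
    (if [disjoint A & A'] then c (cell2 (A :|: A') B) else 0).

Lemma join_value0l c A' B : join_value c set0 A' B = c (cell2 A' B).
Proof.
by rewrite /join_value inversions0l cards0 mul1r set0U -setI_eq0 set0I eqxx.
Qed.

Lemma join_value0r c A B : join_value c A set0 B = (-1) ^+ #|A| * c (cell2 A B).
Proof. by rewrite /join_value inversions0r addn0 setU0 -setI_eq0 setI0 eqxx. Qed.

(** For disjoint A and A' this is, up to a global sign, the cocycle relation of z on the cell with
    factors [A :|: A'] and B. *)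
Lemma join_value_coboundary k z A A' B : z \in cocycle k ->
  is_cell (cell3 A A' B) ->
  \sum_(x in A) (-1) ^+ pos A x * join_value z (A :\ x) A' B +
  (\sum_(x in A') (-1) ^+ (#|A|.-1 + pos A' x) * join_value z A (A' :\ x) B +
   \sum_(x in B) (-1) ^+ (#|A|.-1 + #|A'|.-1 + pos B x) *
     join_value z A A' (B :\ x)) = 0.
Proof.
move=> /andP[hz /eqP dz]; rewrite is_cell3 -!card_gt0 => /and5P[A0 A'0 B0 dAB dA'B].
case: (boolP [disjoint A & A']) => dAA'.
  have hc : is_cell (cell2 (A :|: A') B).
    rewrite is_cell2 -!card_gt0 B0 -setI_eq0 setIUl setU_eq0 !setI_eq0 dAB dA'B.
    by rewrite (leq_trans A0) // subset_leq_card // subsetUl.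
  have := coboundary_cell2 hz hc; rewrite dz ffunE big_disjointU //= => /esym.
  move=> /(congr1 (fun t => - (-1) ^+ (#|A| + inversions A A') * t)).
  rewrite mulr0 -addrA !mulrDr !mulr_sumr => e0; apply: etrans e0.
  congr (_ + (_ + _)); apply: eq_bigr => x xX; rewrite /join_value.
  - rewrite (disjointWl (subD1set _ _) dAA') !mulrA mulNr -!exprD posU //.
    have -> : A :\ x :|: A' = (A :|: A') :\ x.
      by rewrite setDUl [A' :\ x]setD1_id // (disjointFr dAA' xX).
    congr (_ * _); apply: signr_opp.
    rewrite (cardsD1 x A) xX (inversionsDl A' xX) !oddD /=.
    by do 4!case: (odd _).
  - rewrite (disjointWr (subD1set _ _) dAA') !mulrA mulNr -!exprD posU //.
    have xA : x \notin A by rewrite (disjointFl dAA' xX).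
    have -> : A :|: A' :\ x = (A :|: A') :\ x by rewrite setDUl [A :\ x]setD1_id.
    congr (_ * _); apply: signr_opp.
    rewrite (inversionsDr A xX) -subn1 !oddD oddB // (card_pos A x) (negPf xA).
    by rewrite !oddD /=; do 5!case: (odd _).
  rewrite dAA' !mulrA mulNr -!exprD; congr (_ * _); apply: signr_opp.
  rewrite cardsU; move: (dAA'); rewrite -setI_eq0 => /eqP ->; rewrite cards0 subn0.
  case: #|A| A0 => // a _; case: #|A'| A'0 => // a' _.
  by rewrite [(_ + a'.+1)%N]addnS !succnK !oddD !oddS; do 4!case: (odd _).
(* At a common point x, only deleting x from A or from A' can make the two sets disjoint. Both
   deletions have the same join, and their signs are opposite. *)
have [x] : exists x, x \in A :&: A' by apply/set0Pn; rewrite setI_eq0.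
rewrite inE => /andP[xA xA'].
have meet (C C' : {set 'I_n}) y : y \in C -> y \in C' -> [disjoint C & C'] = false.
  by move=> yC yC'; apply/negP => /disjointFr/(_ yC); rewrite yC'.
rewrite [X in _ + (_ + X)]big1 ?addr0 => [|y _]; last first.
  by rewrite /join_value (meet _ _ x) // !mulr0.
rewrite (big_setD1 x) //= big1 ?addr0 => [|y]; last first.
  rewrite !inE => /andP[yx _].
  by rewrite /join_value (meet _ _ x) ?mulr0 // !inE eq_sym yx.
rewrite (big_setD1 x) //= big1 ?addr0 => [|y]; last first.
  rewrite !inE => /andP[yx _].
  by rewrite /join_value (meet _ _ x) ?mulr0 // !inE eq_sym yx.
rewrite /join_value.
have -> : A :\ x :|: A' = A :|: A' :\ x.
  by apply/setP => y; rewrite !inE; case: (eqVneq y x) => [->|]; rewrite ?xA ?xA'.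
have -> : [disjoint A :\ x & A'] = [disjoint A & A' :\ x].
  rewrite -!setI_eq0; congr (_ == _); apply/setP => y; rewrite !inE.
  by case: (y == x); rewrite ?andbF.
rewrite !mulrA -!exprD -mulrDl.
rewrite (@signr_opp _ (#|A|.-1 + pos A' x + (#|A| + inversions A (A' :\ x)))).
  by rewrite addNr mul0r.
have e := card_pos A x; rewrite xA addn1 in e.
rewrite (inversionsDl _ xA) (inversionsDr (A :\ x) xA').
have -> : (\sum_(a in A :\ x) (x < a) = \sum_(a in A) (x < a))%N.
  by rewrite [RHS](big_setD1 x) //= ltnn.
rewrite (cardsD1 x A) xA in e *.
move: e; rewrite add1n => -[->] /=; rewrite !oddD /= !oddD pos_self.
by do 4!case: (odd _).
Qed.

Definition join_cochain c : cochains fork Kn :=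
  [ffun eta : setfun fork Kn => if is_cell eta then
     join_value c (eta (ord0 : 'I_3)) (eta mid3) (eta (ord_max : 'I_3)) else 0].

Lemma join_cochain_cell3 c A A' B : is_cell (cell3 A A' B) ->
  join_cochain c (cell3 A A' B) = join_value c A A' B.
Proof. by move=> hc; rewrite ffunE hc !cell3E. Qed.

(** Unlike in [drop_card_guard], the term of a singleton may be nonzero: it is an end of the
    homotopy. *)
Lemma card_guard A (F : 'I_n -> int) : A != set0 ->
  \sum_(w in A | (1 < #|A|)%N) F w =
  \sum_(w in A) F w - (if #|A| == 1%N then \sum_(w in A) F w else 0).
Proof.
rewrite -card_gt0 => A0; case: (ltngtP #|A| 1%N) => [|A1|A1].
- by rewrite ltnS leqNgt A0.
- by rewrite subr0; apply: eq_bigl => w; rewrite andbT.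
- by rewrite subrr big_pred0 // => w; rewrite andbF.
Qed.

(** [join_value_coboundary] also deletes the point of a singleton factor, which the boundary of a
    cell does not. The excess terms are the two pullbacks: a singleton A leaves the value on A' x B,
    a singleton A' the value on A x B up to sign, and a singleton B leaves zero. *)
Lemma coboundary_join_cochain k z : z \in cocycle k ->
  coboundary (join_cochain z) = pullback (leg ord0) z - pullback (leg mid3) z.
Proof.
move=> hz; have /andP[cz _] := hz; apply/ffunP; apply: cell3_ind => A A' B.
rewrite [RHS]ffunE [X in _ = _ + X]ffunE.
case: (boolP (is_cell (cell3 A A' B))) => hc; last first.
  by rewrite !ffunE (negPf hc) subrr.
rewrite pullback_leg0 // pullback_leg1 // ffunE hc big_ord3 /= !cell3E.
have := hc; rewrite is_cell3 => /and5P[A0 A'0 B0 dAB dA'B].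
under eq_bigr => w /andP[wA A1].
  rewrite facet_sign_cell3_0 facet_cell3_0 join_cochain_cell3; last first.
    by rewrite -facet_cell3_0 facet_cell // cell3E.
over.
under [X in _ + (X + _)]eq_bigr => w /andP[wA A1].
  rewrite facet_sign_cell3_1 facet_cell3_1 join_cochain_cell3; last first.
    by rewrite -facet_cell3_1 facet_cell // cell3E.
over.
under [X in _ + (_ + X)]eq_bigr => w /andP[wA A1].
  rewrite facet_sign_cell3_2 facet_cell3_2 join_cochain_cell3; last first.
    by rewrite -facet_cell3_2 facet_cell // cell3E.
over.
rewrite !card_guard //.
have -> : (if #|A| == 1%N then \sum_(w in A) (-1) ^+ pos A w *
      join_value z (A :\ w) A' B else 0) =
    if #|A| == 1%N then z (cell2 A' B) else 0.
  case: ifP => // /cards1P[x ->].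
  by rewrite big_set1 setDv join_value0l pos_sum big_set1 ltnn mul1r.
have -> : (if #|A'| == 1%N then \sum_(w in A') (-1) ^+ (#|A|.-1 + pos A' w) *
      join_value z A (A' :\ w) B else 0) =
    - if #|A'| == 1%N then z (cell2 A B) else 0.
  case: ifP => [/cards1P[x ->]|_]; last by rewrite oppr0.
  rewrite big_set1 setDv join_value0r pos_sum big_set1 ltnn addn0 mulrA -exprD.
  rewrite -[RHS]mulN1r; congr (_ * _); rewrite -[RHS]expr1; apply: signr_eq.
  by move: A0; rewrite -card_gt0; case: #|A| => // a _; rewrite addnS /= addnn odd_double.
have -> : (if #|B| == 1%N then \sum_(w in B) (-1) ^+ (#|A|.-1 + #|A'|.-1 + pos B w) *
      join_value z A A' (B :\ w) else 0) = 0.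
  case: ifP => // /cards1P[x ->]; rewrite big_set1 setDv /join_value.
  by rewrite (cochain_noncell cz) ?if_same ?mulr0 // is_cell2 eqxx andbF.
have := join_value_coboundary hz hc; set a := \sum_(w in A) _.
set b := \sum_(w in A') _; set d := \sum_(w in B) _.
set u := (if _ then _ else _); set v := (if _ then _ else _).
by move=> e; apply/eqP; rewrite -subr_eq0 -[X in _ == X]e; apply/eqP; ring.
Qed.

Lemma join_cochainP k c : cochain k.+1 c -> cochain k (join_cochain c).
Proof.
move=> hc; apply/cochainP; apply: cell3_ind => A A' B.
case: (boolP (is_cell (cell3 A A' B))) => /= hAB; last by rewrite ffunE (negPf hAB).
rewrite join_cochain_cell3 // celldim_cell3 /join_value => hk.
case: ifP => dAA'; rewrite ?mulr0 //.
move/cochainP: hc => ->; rewrite ?mulr0 //; apply: contra hk => /andP[_].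
rewrite celldim_cell2 cardsU.
move: hAB; rewrite is_cell3 -!card_gt0 => /and5P[A0 A'0 B0 _ _].
move: dAA'; rewrite -setI_eq0 => /eqP ->; rewrite cards0 subn0.
by case: #|A| A0 => // a _; case: #|A'| A'0 => // a' _; rewrite /=; lia.
Qed.

(** A join of nonempty disjoint sets has positive dimension; in degree 0 the two pullbacks thus
    agree on the nose. *)
Lemma join_cochain0 c : cochain 0 c -> join_cochain c = 0.
Proof.
move=> hc; apply/ffunP; apply: cell3_ind => A A' B; rewrite [RHS]ffunE.
case: (boolP (is_cell (cell3 A A' B))) => hAB; last by rewrite ffunE (negPf hAB).
rewrite join_cochain_cell3 // /join_value.
case: ifP => dAA'; rewrite ?mulr0 //.
move/cochainP: hc => ->; rewrite ?mulr0 // negb_and celldim_cell2 cardsU.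
move: hAB; rewrite is_cell3 -!card_gt0 => /and5P[A0 A'0 B0 _ _].
move: dAA'; rewrite -setI_eq0 => /eqP ->; rewrite cards0 subn0.
by case: #|A| A0 => // a _; case: #|A'| A'0 => // a' _; rewrite addnS orbT.
Qed.

Lemma legs_cohomologous k z : z \in cocycle k ->
  is_reduced_coboundary k (pullback (leg ord0) z - pullback (leg mid3) z).
Proof.
move=> hz; rewrite -(coboundary_join_cochain hz); case/andP: hz => cz _.
case: k cz => [|j] cz; last by exists (join_cochain z) => //; exact: join_cochainP.
by exists 0; rewrite join_cochain0 // !raddf0.
Qed.

End ForkComplex.

(** * Going around the cycle *)

(** Groups ordered pairs into unordered ones, so that inversions of different maps can be compared
    pair by pair. *)
Lemma sum_pairs_sym (m : nat) (P : rel 'I_m) (w : 'I_m -> 'I_m -> nat) :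
  (forall u, ~~ P u u) -> (forall u v, w u v = w v u) ->
  (\sum_u \sum_(v | P u v) w u v =
   \sum_(u : 'I_m) \sum_(v : 'I_m | u < v) (P u v + P v u) * w u v)%N.
Proof.
move=> irr wC.
transitivity (\sum_(u : 'I_m) \sum_(v : 'I_m)
    ((u < v) * (P u v * w u v) + (v < u) * (P u v * w u v)))%N.
  apply: eq_bigr => u _; rewrite big_mkcond; apply: eq_bigr => v _.
  case: (ltngtP u v) => [_|_|/val_inj <-]; last by rewrite (negPf (irr u)).
    by rewrite mul1n addn0; case: (P u v); rewrite ?mul1n.
  by rewrite mul1n add0n; case: (P u v); rewrite ?mul1n.
under eq_bigr => u _ do rewrite big_split.
rewrite big_split /= [X in (_ + X)%N]exchange_big -big_split /=.
apply: eq_bigr => u _; rewrite -big_split [RHS]big_mkcond /=.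
apply: eq_bigr => v _; rewrite (wC v u).
by case: (u < v)%N; rewrite ?mul1n ?mul0n // mulnDl.
Qed.

Lemma sum_image_support (T T' : finType) (f : T -> T') (F : T' -> nat) :
  injective f -> (forall y, y \notin f @: [set: T] -> F y = 0%N) ->
  (\sum_y F y = \sum_x F (f x))%N.
Proof.
move=> f_inj F0; rewrite (bigID (mem (f @: [set: T]))) /=.
rewrite [X in (_ + X)%N]big1 ?addn0 // big_imset /=; last by move=> x y _ _; exact: f_inj.
by apply: eq_bigl => x; rewrite inE.
Qed.

(** * Functoriality of the signed pullback *)

Section Composition.
Variables (G G' G'' H : graph).
Variables (phi : vertex G -> vertex G') (psi : vertex G' -> vertex G'').
Hypotheses (phi_inj : injective phi) (psi_inj : injective psi).
Hypothesis psi_hom : graph_hom psi.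

Lemma pull_cell_comp (eta : setfun G'' H) :
  pull_cell phi (pull_cell psi eta) = pull_cell (psi \o phi) eta.
Proof. by apply/ffunP => v; rewrite !ffunE. Qed.

(** A pair is inverted by the composite exactly when one of the two maps inverts it and the other
    does not. The equality of dimensions makes the factors outside the image of [phi] points, which
    contribute nothing. *)
Lemma odd_reorder_sign_comp (eta : setfun G'' H) :
  celldim (pull_cell phi (pull_cell psi eta)) = celldim (pull_cell psi eta) ->
  odd (reorder_sign psi eta + reorder_sign phi (pull_cell psi eta)) =
  odd (reorder_sign (psi \o phi) eta).
Proof.
move=> /eqP; rewrite celldim_pull_eq // sum_nat_eq0 => /forallP off0.
pose d u := #|eta (psi (phi u))|.-1.
have d0 y : y \notin phi @: [set: vertex G] -> #|eta (psi y)|.-1 = 0%N.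
  by move=> yim; have /implyP/(_ yim)/eqP := off0 y; rewrite ffunE.
have -> : reorder_sign psi eta =
    (\sum_u \sum_(v | (phi u < phi v) && (psi (phi v) < psi (phi u))) d u * d v)%N.
  rewrite /reorder_sign (sum_image_support phi_inj) => [|y yim]; last first.
    by rewrite big1 // => v _; rewrite d0.
  apply: eq_bigr => u _; rewrite big_mkcond (sum_image_support phi_inj).
    by rewrite [RHS]big_mkcond.
  by move=> y yim; rewrite (d0 y) // muln0 if_same.
rewrite (sum_pairs_sym
  (P := fun u v => (phi u < phi v)%N && (psi (phi v) < psi (phi u))%N));
  [|by move=> u; rewrite ltnn|by move=> u v; rewrite mulnC].
have -> : reorder_sign phi (pull_cell psi eta) =
    (\sum_(u : vertex G) \sum_(v : vertex G | u < v) (phi v < phi u) * (d u * d v))%N.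
  apply: eq_bigr => u _; rewrite big_mkcondr; apply: eq_bigr => v _.
  by rewrite !ffunE; case: ifP; rewrite ?mul1n.
have -> : reorder_sign (psi \o phi) eta = (\sum_(u : vertex G)
    \sum_(v : vertex G | u < v) (psi (phi v) < psi (phi u)) * (d u * d v))%N.
  apply: eq_bigr => u _; rewrite big_mkcondr; apply: eq_bigr => v _.
  by case: ifP; rewrite ?mul1n.
rewrite -big_split /= !(big_morph odd oddD (erefl _)).
apply: eq_bigr => u _; rewrite -big_split /= !(big_morph odd oddD (erefl _)).
apply: eq_bigr => v uv; rewrite -mulnDl !oddM; congr (_ && _).
have uv' : u != v by rewrite neq_ltn uv.
have : phi u != phi v by rewrite (inj_eq phi_inj).
have : psi (phi u) != psi (phi v) by rewrite !(inj_eq psi_inj, inj_eq phi_inj).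
rewrite -!val_eqE /=.
by case: (ltngtP (phi u) (phi v)); case: (ltngtP (psi (phi u)) (psi (phi v))).
Qed.

Lemma pullback_comp (c : cochains G H) :
  pullback psi (pullback phi c) = pullback (psi \o phi) c.
Proof.
apply/ffunP => eta; rewrite 3!ffunE pull_cell_comp.
case: (boolP (is_cell eta)) => //= he; rewrite (pull_is_cell psi_hom he) /=.
have e1 := celldim_pull psi_inj eta.
have e2 := celldim_pull phi_inj (pull_cell psi eta).
rewrite pull_cell_comp in e2.
(* Each stage can only lower the dimension, so equality for the composite forces equality at both
   stages. *)
case: eqP => e3; last first.
  by case: eqP => // e4; case: e3; move: e1 e2 e4; lia.
rewrite -e3; case: eqP => e4; rewrite ?mulr0 // mulrA -exprD; congr (_ * _).
by apply: signr_eq; rewrite odd_reorder_sign_comp // pull_cell_comp.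
Qed.

End Composition.

Section ReducedCoboundary.
Variables (G G' H : graph) (k : nat).

Lemma is_reduced_coboundaryB (b c : cochains G H) : is_reduced_coboundary k b ->
  is_reduced_coboundary k c -> is_reduced_coboundary k (b - c).
Proof.
case: k => [|j] /=; first by move=> [x ->] [y ->]; exists (x - y); rewrite raddfB.
move=> [x hx ->] [y hy ->]; exists (x - y); last by rewrite raddfB.
by have [_ cB] := cochain_zmod_closed G H j; exact: cB.
Qed.

Lemma is_reduced_coboundary0 : is_reduced_coboundary k (0 : cochains G H).
Proof.
case: k => [|j] /=; first by exists 0; rewrite raddf0.
by exists 0; [exact: (cochain_zmod_closed G H j).1 | rewrite raddf0].
Qed.

Lemma is_reduced_coboundaryD (b c : cochains G H) : is_reduced_coboundary k b ->
  is_reduced_coboundary k c -> is_reduced_coboundary k (b + c).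
Proof.
move=> hb hc; rewrite -[c]opprK -[- c]add0r.
by do ![apply: is_reduced_coboundaryB => //]; exact: is_reduced_coboundary0.
Qed.

Lemma is_reduced_coboundary_pullback (phi : vertex G -> vertex G') (c : cochains G H) :
  graph_hom phi -> injective phi ->
  is_reduced_coboundary k c -> is_reduced_coboundary k (pullback phi c).
Proof.
move=> phi_hom phi_inj; case: k => [|j] /= [b].
  by move=> ->; exists b; rewrite pullback_augmentation.
move=> hb ->; exists (pullback phi b); first exact: pullback_cochain.
by rewrite coboundary_pullback.
Qed.

End ReducedCoboundary.

(** * Relations between pullbacks along oriented edges *)

Definition edge_map (G : graph) (x y : vertex G) (v : vertex (complete_graph 2)) :
    vertex G :=
  if v == ord0 :> 'I_2 then x else y.

Section EdgeMaps.
Variables (G : graph) (n k : nat) (z : cochains (complete_graph 2) (complete_graph n)).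
Hypotheses (n_gt0 : (0 < n)%N) (n_even : ~~ odd n) (z_cocycle : z \in cocycle k).
Implicit Types x y s : vertex G.

Lemma edge_map_hom x y : edge x y -> graph_hom (edge_map x y).
Proof.
by move=> xy; apply: ord2P; apply: ord2P => //= _; rewrite /edge_map // edge_sym.
Qed.

Lemma edge_map_injective x y : x != y -> injective (edge_map x y).
Proof.
by move=> xy; apply: ord2P; apply: ord2P; rewrite /edge_map //= => e;
  move: xy; rewrite e eqxx.
Qed.

Lemma reversed_edge x y : edge x y -> x != y ->
  is_reduced_coboundary k (pullback (edge_map x y) z + pullback (edge_map y x) z).
Proof.
move=> xy nxy; have -> : edge_map y x = edge_map x y \o @swap.
  by apply/funext; apply: ord2P.
rewrite -pullback_comp; [|exact: swap_inj|exact: edge_map_injective|exact: edge_map_hom].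
rewrite -raddfD; apply: is_reduced_coboundary_pullback.
- exact: edge_map_hom.
- exact: edge_map_injective.
exact: swap_cocycle.
Qed.

Lemma moved_edge x s y : edge x y -> edge s y -> x != y -> s != y -> x != s ->
  is_reduced_coboundary k (pullback (edge_map x y) z - pullback (edge_map s y) z).
Proof.
move=> xy sy nxy nsy nxs.
pose psi (v : vertex fork) : vertex G := tnth [tuple x; s; y] v.
have psi_inj : injective psi.
  by apply: ord3P; apply: ord3P; rewrite /psi !(tnth_nth x) //= => e;
    move: nxy nsy nxs; rewrite e eqxx.
have psi_hom : graph_hom psi.
  by apply: ord3P; apply: ord3P; rewrite //= /psi !(tnth_nth x) //= => _;
    rewrite edge_sym.
have -> : edge_map x y = psi \o leg ord0 by apply/funext; apply: ord2P.
have -> : edge_map s y = psi \o leg mid3 by apply/funext; apply: ord2P.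
have comp e : e != ord_max ->
    pullback (psi \o leg e) z = pullback psi (pullback (leg e) z).
  by move=> e2; rewrite pullback_comp //; exact: leg_inj.
rewrite !comp //.
rewrite -(pullback_is_zmod_morphism psi); apply: is_reduced_coboundary_pullback => //.
exact: legs_cohomologous.
Qed.

Lemma next_edge x y s : edge x y -> edge y s -> x != y -> y != s -> x != s ->
  is_reduced_coboundary k (pullback (edge_map x y) z + pullback (edge_map y s) z).
Proof.
move=> xy ys nxy nys nxs.
rewrite -(subrK (pullback (edge_map s y) z) (pullback (edge_map x y) z)) -addrA.
apply: is_reduced_coboundaryD.
  by apply: moved_edge; rewrite // 1?edge_sym // eq_sym.
by apply: reversed_edge; rewrite 1?edge_sym // eq_sym.
Qed.

End EdgeMaps.

Section Round.
Variables (r n k : nat) (z : cochains (complete_graph 2) (complete_graph n)).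
Hypotheses (r_gt0 : (0 < r)%N).
Hypotheses (n_gt0 : (0 < n)%N) (n_even : ~~ odd n) (z_cocycle : z \in cocycle k).

Definition residue (i : nat) : vertex (cycle_graph r) :=
  Ordinal (ltn_pmod i (isT : 0 < r.*2.+1)%N).

Lemma residueD i : residue (i + r.*2.+1) = residue i.
Proof. by apply: val_inj; rewrite /= modnDr. Qed.

Lemma residue_neq i j : (0 < j < r.*2.+1)%N -> residue i != residue (i + j).
Proof.
move=> /andP[j0 jr]; rewrite -val_eqE /= -{1}[i]addn0 eqn_modDl mod0n.
by rewrite modn_small // eq_sym -lt0n.
Qed.

Lemma residue_edge i : edge (residue i) (residue i.+1).
Proof. by rewrite /= /cycle_edge /= -[in X in _ == X]addn1 modnDml addn1 eqxx. Qed.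

Lemma double_edge j : is_reduced_coboundary k
  (pullback (edge_map (residue j) (residue j.+1)) z *+ 2).
Proof.
pose E i := pullback (edge_map (residue i) (residue i.+1)) z.
have step i : is_reduced_coboundary k (E i + E i.+1).
  apply: next_edge => //; rewrite ?residue_edge //.
  - by rewrite -addn1 residue_neq //= ltnS double_gt0.
  - by rewrite -[i.+2]addn1 residue_neq //= ltnS double_gt0.
  by rewrite -addn2 residue_neq //= ltnS -muln2 leq_pmull.
have around m : is_reduced_coboundary k (E j + E (j + m.*2.+1)%N).
  elim: m => [|m IHm]; first by rewrite addn1.
  have -> : E j + E (j + m.+1.*2.+1)%N = (E j + E (j + m.*2.+1)%N) -
     (E (j + m.*2.+1)%N + E (j + m.*2.+1).+1) +
     (E (j + m.*2.+1).+1 + E (j + m.*2.+1).+2).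
    by rewrite doubleS !addnS opprD !addrA addrK subrK.
  by apply: is_reduced_coboundaryD => //; apply: is_reduced_coboundaryB.
(* For m = r the shift is 2r + 1, a full turn, which comes back to the starting edge. *)
by have := around r; rewrite /E residueD -addSn residueD mulr2n.
Qed.

Lemma double_edge_map (phi : vertex (complete_graph 2) -> vertex (cycle_graph r)) :
  graph_hom phi -> is_reduced_coboundary k (pullback phi z *+ 2).
Proof.
move=> phi_hom; have -> : phi = edge_map (phi (ord0 : 'I_2)) (phi (ord_max : 'I_2)).
  by apply/funext; apply: ord2P.
have := phi_hom (ord0 : 'I_2) (ord_max : 'I_2) isT.
move: (phi _) (phi _) => x y xy.
have residueE (v w : vertex (cycle_graph r)) : (w == v.+1 %% r.*2.+1 :> nat)%N ->
    exists j, v = residue j /\ w = residue j.+1.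
  move=> /eqP vw; exists v; split; apply: val_inj => //=.
  by rewrite modn_small.
case/orP: xy => /residueE [j [-> ->]]; first exact: double_edge.
(* Here the edge is traversed against the orientation of the cycle; E and E' are opposite modulo
   coboundaries. *)
set E := pullback _ z; pose E' := pullback (edge_map (residue j) (residue j.+1)) z.
have EE' : is_reduced_coboundary k (E' + E).
  apply: reversed_edge => //; first exact: residue_edge.
  by rewrite -addn1 residue_neq //= ltnS double_gt0.
have -> : E *+ 2 = (E' + E) + (E' + E) - E' *+ 2.
  by rewrite -mulr2n mulrnDl addrC addKr.
apply: is_reduced_coboundaryB; last exact: double_edge.
exact: is_reduced_coboundaryD.
Qed.

End Round.

Theorem theorem2p6 (r n : nat) (r_gt0 : (1 <= r)%N) (n_ge2 : (2 <= n)%N)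
    (n_even : ~~ odd n)
    (iota : vertex (complete_graph 2) -> vertex (cycle_graph r))
    (iota_hom : graph_hom iota)
    (iota_edge : iota @: [set: vertex (complete_graph 2)] = [set inord r; inord r.+1])
    (k : nat) (x : red_cohomology (complete_graph 2) (complete_graph n) k) :
  induced iota_hom (edge_map_inj r_gt0 iota_edge) k x *+ 2 = 0.
Proof.
rewrite /induced -raddfMn -[RHS](raddf0 \pi%qT).
apply/eqP; rewrite -Quotient.idealrBE subr0; apply/asboolP.
rewrite -[cochain_of _]/(val _) raddfMn /=.
apply: double_edge_map => //; first exact: ltnW.
exact: cocycleP.
Qed.
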